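(* Let $f$ be a smooth function on an open subset $U$ of $\mathbb{R}^3$, homogeneous of degree $d>2$, such that the Hessian determinant $H(f)=\det(\partial^2 f/\partial x_i\partial x_j)$ is nonzero on $U$. Consider the pseudo-Riemannian metric $-\frac{1}{d(d-1)}\partial^2 f/\partial x_i\partial x_j$ on $U$, and let $M=\{x\in U: f(x)=1\}$ with the restricted metric. Then at any point of $M$, the sectional curvature of $U$ on the tangent 2-plane to $M$ is $$K=\frac{d^2(d-1)^2}{4(d-2)^2}\,\frac{S(f)\,f}{H(f)^2},$$ and the sectional curvature of the surface $M$ at that point is $$K_M=-\frac{d^2}{4}+\frac{d^2(d-1)^2}{4(d-2)^2}\,\frac{S(f)\,f^2}{H(f)^2}.$$
   Context: Write $f_{ijk}=\partial^3 f/\partial x_i\partial x_j\partial x_k$ and set $a_3=f_{333}$, $a_2=f_{133}$, $b_2=f_{233}$, $a_1=f_{113}$, $b_1=f_{123}$, $c_1=f_{223}$, $a_0=f_{111}$, $b_0=f_{112}$, $c_0=f_{122}$, $d_0=f_{222}$. The Clebsch covariant $S(f)$ is $S(f)=-(a_0a_2-a_1^2)c_1^2+(a_0a_3-a_1a_2)c_0c_1-(a_1a_3-a_2^2)c_0^2-b_0^2a_3c_1+b_0b_1(3a_2c_1+a_3c_0)-(b_0b_2+2b_1^2)(a_1c_1+a_2c_0)+b_1b_2(a_0c_1+3a_1c_0)-b_2^2a_0c_0+d_0[b_0(a_1a_3-a_2^2)-b_1(a_0a_3-a_1a_2)+b_2(a_0a_2-a_1^2)]+(b_0b_2-b_1^2)^2.$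 Sectional curvature of a 2-plane spanned by $v,w$ uses the standard formula $R(v,w,v,w)/(\langle v,v\rangle\langle w,w\rangle-\langle v,w\rangle^2)$ for the Levi-Civita connection of the pseudo-Riemannian metric. *)

(* Defs.v *)
From HB Require Import structures.
From mathcomp Require Import all_boot all_order all_algebra.
From mathcomp Require Import all_classical all_reals all_analysis.
Set Implicit Arguments. Unset Strict Implicit. Unset Printing Implicit Defensive.
Import Order.TTheory GRing.Theory Num.Theory.
Import numFieldNormedType.Exports.
Local Open Scope classical_set_scope.
Local Open Scope ring_scope.

Section Defs.
Variable R : realType.

Definition ev n (i : 'I_n) : 'rV[R]_n := delta_mx 0 i.

Definition pd n (i : 'I_n) (F : 'rV[R]_n -> R) (x : 'rV[R]_n) : R :=
  derive F x (ev i).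

Fixpoint pds n (l : seq 'I_n) (F : 'rV[R]_n -> R) : 'rV[R]_n -> R :=
  match l with
  | [::] => F
  | i :: l' => pd i (pds l' F)
  end.

Definition smooth_on n (U : set 'rV[R]_n) (F : 'rV[R]_n -> R) : Prop :=
  forall (l : seq 'I_n) (x : 'rV[R]_n), U x ->
    {for x, continuous (pds l F)} /\ forall i, derivable (pds l F) x (ev i).

Definition homogeneous_on (U : set 'rV[R]_3) (f : 'rV[R]_3 -> R) (d : R) : Prop :=
  forall (x : 'rV[R]_3) (t : R), U x -> 0 < t -> U (t *: x) ->
    f (t *: x) = t `^ d * f x.

Definition hess n (f : 'rV[R]_n -> R) (x : 'rV[R]_n) : 'M[R]_n :=
  \matrix_(i, j) pd i (pd j f) x.
Definition hessdet n (f : 'rV[R]_n -> R) (x : 'rV[R]_n) : R := \det (hess f x).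

Definition fmetric (f : 'rV[R]_3 -> R) (d : R) (x : 'rV[R]_3) : 'M[R]_3 :=
  (- (d * (d - 1))^-1) *: hess f x.

Definition bil n (G : 'rV[R]_n -> 'M[R]_n) (x v w : 'rV[R]_n) : R :=
  \sum_(i < n) \sum_(j < n) v 0 i * G x i j * w 0 j.

Definition Gamma n (G : 'rV[R]_n -> 'M[R]_n) (k i j : 'I_n) (x : 'rV[R]_n) : R :=
  2^-1 * \sum_(l < n) invmx (G x) k l *
    (pd i (fun y => G y j l) x + pd j (fun y => G y i l) x
     - pd l (fun y => G y i j) x).

(* R(d_i,d_j) d_k = sum_l Riem l i j k d_l, with R(X,Y) = [nabla_X,nabla_Y] - nabla_[X,Y] *)
Definition Riem n (G : 'rV[R]_n -> 'M[R]_n) (l i j k : 'I_n) (x : 'rV[R]_n) : R :=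
  pd i (Gamma G l j k) x - pd j (Gamma G l i k) x
  + \sum_(m < n) (Gamma G l i m x * Gamma G m j k x
                  - Gamma G l j m x * Gamma G m i k x).

Definition Rm n (G : 'rV[R]_n -> 'M[R]_n) (i j k m : 'I_n) (x : 'rV[R]_n) : R :=
  \sum_(l < n) Riem G l i j k x * G x l m.

Definition sec_curv n (G : 'rV[R]_n -> 'M[R]_n) (x v w : 'rV[R]_n) : R :=
  (\sum_(i < n) \sum_(j < n) \sum_(k < n) \sum_(m < n)
      v 0 i * w 0 j * w 0 k * v 0 m * Rm G i j k m x)
  / (bil G x v v * bil G x w w - (bil G x v w) ^+ 2).

Definition tangent (f : 'rV[R]_3 -> R) (p v : 'rV[R]_3) : Prop :=
  \sum_(i < 3) pd i f p * v 0 i = 0.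

Definition dphi (phi : 'rV[R]_2 -> 'rV[R]_3) (a : 'I_2) (u : 'rV[R]_2) : 'rV[R]_3 :=
  derive phi u (ev a).

Definition pullback (G : 'rV[R]_3 -> 'M[R]_3) (phi : 'rV[R]_2 -> 'rV[R]_3)
  (u : 'rV[R]_2) : 'M[R]_2 :=
  \matrix_(a, b) bil G (phi u) (dphi phi a u) (dphi phi b u).

Definition o0 : 'I_3 := Ordinal (isT : (0 < 3)%N).
Definition o1 : 'I_3 := Ordinal (isT : (1 < 3)%N).
Definition o2 : 'I_3 := Ordinal (isT : (2 < 3)%N).

Definition f3 (f : 'rV[R]_3 -> R) (i j k : 'I_3) (x : 'rV[R]_3) : R :=
  pd i (pd j (pd k f)) x.

Definition clebsch (f : 'rV[R]_3 -> R) (x : 'rV[R]_3) : R :=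
  let a3 := f3 f o2 o2 o2 x in
  let a2 := f3 f o0 o2 o2 x in
  let b2 := f3 f o1 o2 o2 x in
  let a1 := f3 f o0 o0 o2 x in
  let b1 := f3 f o0 o1 o2 x in
  let c1 := f3 f o1 o1 o2 x in
  let a0 := f3 f o0 o0 o0 x in
  let b0 := f3 f o0 o0 o1 x in
  let c0 := f3 f o0 o1 o1 x in
  let d0 := f3 f o1 o1 o1 x in
  - (a0 * a2 - a1 ^+ 2) * c1 ^+ 2 + (a0 * a3 - a1 * a2) * c0 * c1
  - (a1 * a3 - a2 ^+ 2) * c0 ^+ 2 - b0 ^+ 2 * a3 * c1
  + b0 * b1 * (3 * a2 * c1 + a3 * c0)
  - (b0 * b2 + 2 * b1 ^+ 2) * (a1 * c1 + a2 * c0)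
  + b1 * b2 * (a0 * c1 + 3 * a1 * c0) - b2 ^+ 2 * a0 * c0
  + d0 * (b0 * (a1 * a3 - a2 ^+ 2) - b1 * (a0 * a3 - a1 * a2)
          + b2 * (a0 * a2 - a1 ^+ 2))
  + (b0 * b2 - b1 ^+ 2) ^+ 2.

End Defs.
Arguments ev {R n} i.

(* Main.v *)
Require Import Defs.
From HB Require Import structures.
From mathcomp Require Import all_boot all_order all_algebra.
From mathcomp Require Import all_classical all_reals all_analysis.
From mathcomp Require Import perm ring lra.
Import Order.TTheory GRing.Theory Num.Theory.
Import numFieldNormedType.Exports.
Local Open Scope classical_set_scope.
Local Open Scope ring_scope.

(* Let [x] be a point of M and [H = hess f].  By Euler's identities H(x,x) = d(d-1)f,
   H(x,.) = (d-1) df and f3(x,.,.) = (d-2) H, so the position vector [x] is normal to M.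
   For a Hessian metric the fourth derivatives cancel from the curvature tensor, which is
   up to a factor N = <f3(v,v,.), f3(w,w,.)> - <f3(v,w,.), f3(v,w,.)> for the pairing of
   covectors by the inverse of H.  In a basis x, v, w with v, w tangent, the
   components f3(x,x,v) and f3(x,x,w) vanish and the Clebsch quartic S of the cubic form f3
   reduces to a multiple of N; since S is an SL(3)-invariant of weight det^4 (checked on the
   factors of an LUP decomposition), this gives K.  Finally M is totally umbilic:
   the covariant derivative of the normal field [x] along M is d/2 times the identity and
   <x,x> = -1, so the Gauss equation shifts K by -d^2/4. *)

(** * Partial derivatives: mean values, symmetry, chain rule *)

(** The inverse of H is never differentiated explicitly. The covectors f3(v,v,.), f3(v,w,.),
    f3(w,w,.) are represented by vectors [avv], [avw], [aww] that are H-dual to them, so that N =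
    H(avv,aww) - H(avw,avw) and every quantity is a value of H or of f3 on vectors. Let D be the
    Gram determinant of v, w for H. Splitting each dual vector into its part along x and its part in
    the plane gives S(x,v,w) = (d-2)^2 H(x,x) D N, and det H * det(x,v,w)^2 = H(x,x) D then removes
    the choice of basis. With c = -1/(d(d-1)) the curvature is -N/(4cD). One factor d(d-1) of the
    constant comes from -1/c, the other from H(x,x) at f = 1. The coefficient d/2 on M has two
    sources: differentiating df(P) = 0 along M contributes -(d-1), and the Christoffel term of the
    ambient metric contributes (d-2)/2. Smoothness is given through iterated partial derivatives
    only, so Schwarz's theorem and the chain rule are derived from mean values along coordinate
    lines. *)

Lemma is_derive_line {R : realType} {V : normedModType R} {F : V -> R} {x v : V} {s : R} :
  derivable F (x + s *: v) v ->
  is_derive s 1 (fun r : R => F (x + r *: v)) ('D_v F (x + s *: v)).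
Proof.
move=> dF.
have E : (fun h : R => h^-1 *: (F (x + (h *: 1 + s) *: v) - F (x + s *: v))) =
  (fun h : R => h^-1 *: (F (h *: v + (x + s *: v)) - F (x + s *: v))).
  by apply/funext => h; rewrite [h *: 1]mulr1 scalerDl addrCA.
by split; rewrite /derivable /derive /= E.
Qed.

(** Locating the intermediate parameter by [|s| <= |t|] alone treats both signs of [t] uniformly.
    The ordinary mean value theorem is applied on [0, t] or on [t, 0]. *)
Lemma MVT_line {R : realType} {V : normedModType R} (F : V -> R) (x v : V) (t : R) :
  (forall s : R, `|s| <= `|t| -> derivable F (x + s *: v) v) ->
  exists2 s, `|s| <= `|t| & F (x + t *: v) - F x = t * 'D_v F (x + s *: v).
Proof.
move=> dF; pose g r := F (x + r *: v).
have dg (s : R) : `|s| <= `|t| -> is_derive s 1 g ('D_v F (x + s *: v)).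
  by move=> /dF /is_derive_line.
have cg (a b : R) : `|a| <= `|t| -> `|b| <= `|t| -> {within `[a, b], continuous g}.
  move=> ha hb; apply: derivable_within_continuous => s.
  rewrite in_itv /= => /andP[sa sb]; have [] // := dg s _.
  by rewrite ler_norml; move: ha hb; rewrite !ler_norml; lra.
have g0 : F x = g 0 by rewrite /g scale0r addr0.
have [t0|t0] := leP 0 t.
  have [||s] := @MVT_segment _ g (fun s => 'D_v F (x + s *: v)) 0 t t0.
  - move=> s; rewrite in_itv /= => /andP[sa sb]; apply: dg.
    by rewrite (ger0_norm t0) ger0_norm ltW.
  - by apply: cg => //; rewrite normr0.
  rewrite in_itv /= => /andP[sa sb] E; exists s.
    by rewrite (ger0_norm t0) ger0_norm.
  by rewrite g0 E subr0 mulrC.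
have [||s] := @MVT_segment _ g (fun s => 'D_v F (x + s *: v)) t 0 (ltW t0).
- move=> s; rewrite in_itv /= => /andP[sa sb]; apply: dg.
  by rewrite !ltr0_norm // lerN2 ltW.
- by apply: cg => //; rewrite normr0.
rewrite in_itv /= => /andP[sa sb] E; exists s.
  by rewrite (ltr0_norm t0) ler0_norm // lerN2.
by rewrite g0 -opprB E sub0r mulrN opprK mulrC.
Qed.

Lemma smooth_pd {R : realType} {n} {U : set 'rV[R]_n} {F} i :
  smooth_on U F -> smooth_on U (pd i F).
Proof.
move=> sF l x Ux.
have E : pds l (pd i F) = pds (rcons l i) F by elim: l => //= j l ->.
by rewrite E; exact: sF.
Qed.

Lemma smooth_continuous {R : realType} {n} {U : set 'rV[R]_n} {F} {x} :
  smooth_on U F -> U x -> {for x, continuous F}.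
Proof. by move=> sF Ux; have [] := sF [::] x Ux. Qed.

Lemma smooth_derivable {R : realType} {n} {U : set 'rV[R]_n} {F} {x} i :
  smooth_on U F -> U x -> derivable F x (ev i).
Proof. by move=> sF Ux; have [_] := sF [::] x Ux; apply. Qed.

Lemma norm_ev {R : realType} {n} (i : 'I_n) : `|ev i : 'rV[R]_n| = 1.
Proof.
rewrite /Num.Def.normr /= mx_normrE; apply/le_anti/andP; split.
  rewrite (bigmax_le _ ler01) // => j _.
  by rewrite mxE ord1 /=; case: (_ == _); rewrite /= ?normr1 ?normr0 ?ler01 ?lexx.
have := @le_bigmax _ _ _ 0 (fun j : 'I_1 * 'I_n => `|(ev i : 'rV[R]_n) j.1 j.2|) (0, i).
by rewrite /= mxE !eqxx /= normr1.
Qed.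

Lemma norm_coord_le {R : realType} {n} (x : 'rV[R]_n) i : `|x 0 i| <= `|x|.
Proof.
rewrite [leRHS]/Num.Def.normr /= mx_normrE.
exact: (@le_bigmax _ _ _ 0 (fun j : 'I_1 * 'I_n => `|x j.1 j.2|) (0, i)).
Qed.

(** Schwarz's theorem by contradiction. The second difference of [F] is symmetric in the two
    directions, so it produces points [y1], [y2] close to [x] at which the two mixed derivatives
    take exactly the same value. By continuity each is within a quarter of the supposed gap [L] of
    its value at [x]. *)
Lemma pdC {R : realType} {n} (U : set 'rV[R]_n) F x i j :
  open U -> smooth_on U F -> U x -> pd i (pd j F) x = pd j (pd i F) x.
Proof.
move=> oU sF Ux.
have nU : nbhs x U by exact: open_nbhs_nbhs.
have half (e : R) : 0 < e -> e / 2 < e by lra.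
have tri (a b c : R) : `|a - b| <= `|a - c| + `|b - c|.
  by rewrite (distrC b); apply: le_trans (ler_normD _ _); rewrite subrKA.
have quarters (l a b : R) : 0 < l -> a < l / 4 -> b < l / 4 -> l <= a + b -> False by lra.
(* the second difference of F is evaluated by two mean value theorems *)
have key : forall a b e, 0 < e -> exists2 t0, 0 < t0 & forall t, 0 < t -> t <= t0 ->
   exists2 y, `|y - x| <= e &
     (F (x + t *: ev a + t *: ev b) - F (x + t *: ev a)
      - (F (x + t *: ev b) - F x)) = t * (t * pd b (pd a F) y).
  move=> a b e e0.
  have [r /= r0 rU] := (nbhs_ballP x U).1 nU.
  have BU s s' (t : R) : `|s| <= `|t| -> `|s'| <= `|t| -> `|t| < r / 2 ->
      U (x + s *: ev a + s' *: ev b).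
    move=> hs hs' ht; apply: rU; rewrite -ball_normE /= -addrA opprD addNKr normrN.
    apply: le_lt_trans (ler_normD _ _) _; rewrite !normrZ !norm_ev !mulr1; lra.
  (* The intermediate point is displaced by at most [t] in each of two directions, hence by at most
     [2 t]: the first bound keeps this below [e], the second keeps it inside the ball of radius
     [r]. *)
  exists (Num.min (e / 2) (r / 4)); first by rewrite lt_min; apply/andP; split; lra.
  move=> t t0; rewrite le_min => /andP[te tr].
  have tn : `|t| = t by apply: ger0_norm; lra.
  have th : `|t| < r / 2 by rewrite tn; lra.
  pose G y := F (y + t *: ev b) - F y.
  have dsh (s : R) : `|s| <= `|t| -> is_derive (x + s *: ev a) (ev a) G
      (pd a F (x + s *: ev a + t *: ev b) - pd a F (x + s *: ev a)).
    move=> hs.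
    have d1 : derivable F (x + s *: ev a + t *: ev b) (ev a).
      by apply: (smooth_derivable a sF); apply: (BU s t t).
    have d2 : derivable F (x + s *: ev a) (ev a).
      apply: (smooth_derivable a sF); rewrite -[_ + _]addr0 -(scale0r (ev b)).
      by apply: (BU _ _ t) => //; rewrite normr0.
    have E : (fun h : R => h^-1 *: (F (h *: ev a + (x + s *: ev a) + t *: ev b) -
                              F (x + s *: ev a + t *: ev b))) =
             (fun h : R => h^-1 *: (F (h *: ev a + (x + s *: ev a + t *: ev b)) -
                              F (x + s *: ev a + t *: ev b))).
      by apply/funext => h; rewrite -!addrA.
    have d3 : is_derive (x + s *: ev a) (ev a) (fun y => F (y + t *: ev b))
        (pd a F (x + s *: ev a + t *: ev b)).
      by split; rewrite /pd /derivable /derive /= E.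
    exact: (is_deriveB d3 (derivableP d2)).
  have [s hs Es] : exists2 s, `|s| <= `|t| &
      G (x + t *: ev a) - G x = t * 'D_(ev a) G (x + s *: ev a).
    by apply: MVT_line => s /dsh [].
  have [s' hs' Es'] : exists2 s', `|s'| <= `|t| &
      pd a F (x + s *: ev a + t *: ev b) - pd a F (x + s *: ev a) =
      t * 'D_(ev b) (pd a F) (x + s *: ev a + s' *: ev b).
    apply: MVT_line => s' hs'; apply: (smooth_derivable b (smooth_pd a sF)).
    exact: BU th.
  exists (x + s *: ev a + s' *: ev b).
    rewrite [X in `|X|]addrC -addrA addKr.
    by apply: le_trans (ler_normD _ _) _; rewrite !normrZ !norm_ev !mulr1; lra.
  by rewrite -/(G x) -[_ - F (x + t *: ev a)]/(G (x + t *: ev a)) Es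
       (@derive_val _ _ _ _ _ _ _ (dsh s hs)) Es'.
apply/eqP; rewrite -subr_eq0; apply/negPn/negP => ne.
set L := _ - _ in ne.
have L0 : 0 < `|L| by rewrite normr_gt0.
have c1 : {for x, continuous (pd i (pd j F))}.
  exact: smooth_continuous (smooth_pd i (smooth_pd j sF)) Ux.
have c2 : {for x, continuous (pd j (pd i F))}.
  exact: smooth_continuous (smooth_pd j (smooth_pd i sF)) Ux.
have L4 : 0 < `|L| / 4 by lra.
have /cvgrPdist_lt/(_ _ L4)/nbhs_ballP[e1 /= e10 He1] := c1.
have /cvgrPdist_lt/(_ _ L4)/nbhs_ballP[e2 /= e20 He2] := c2.
have e12 : 0 < Num.min (e1 / 2) (e2 / 2) by rewrite lt_min !divr_gt0.
have [t1 t10 H1] := key i j _ e12.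
have [t2 t20 H2] := key j i _ e12.
have tm : 0 < Num.min t1 t2 by rewrite lt_min t10.
have [|y1 hy1 E1] := H1 _ tm; first by rewrite ge_min lexx.
have [|y2 hy2 E2] := H2 _ tm; first by rewrite ge_min lexx orbT.
have Eq : pd j (pd i F) y1 = pd i (pd j F) y2.
  have tn := lt0r_neq0 tm; have := E2; rewrite (addrAC x).
  have -> : forall a b c e : R, a - b - (c - e) = a - c - (b - e) by move=> *; ring.
  by rewrite E1 => /(mulfI tn) /(mulfI tn).
move: hy1 hy2; rewrite !le_min => /andP[hy11 hy12] /andP[hy21 hy22].
have B1 : `|pd j (pd i F) x - pd j (pd i F) y1| < `|L| / 4.
  have b : ball x e2 y1 by rewrite -ball_normE /= distrC (le_lt_trans _ (half _ _)).
  exact: He2 b.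
have B2 : `|pd i (pd j F) x - pd i (pd j F) y2| < `|L| / 4.
  have b : ball x e1 y2 by rewrite -ball_normE /= distrC (le_lt_trans _ (half _ _)).
  exact: He1 b.
rewrite Eq in B1; exact: quarters L0 B2 B1 (tri _ _ _).
Qed.

Lemma normrV_le {R : realType} {n} (x : 'rV[R]_n) (e : R) :
  0 <= e -> (forall i, `|x 0 i| <= e) -> `|x| <= e.
Proof.
move=> e0 xe; rewrite /Num.Def.normr /= mx_normrE bigmax_le // => j _.
by rewrite (ord1 j.1).
Qed.

(* telescoping along the coordinates *)
Lemma coordinate_increments {R : realType} {n} {U : set 'rV[R]_n} {F} {x h : 'rV[R]_n} :
  smooth_on U F -> (forall y, `|y - x| <= `|h| -> U y) ->
  exists xi : 'I_n -> 'rV[R]_n, (forall k, `|xi k - x| <= `|h|) /\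
    F (x + h) - F x = \sum_k h 0 k * pd k F (xi k).
Proof.
move=> sF hU.
pose tr m : 'rV[R]_n := \row_i (if (i < m)%N then h 0 i else 0).
have trS (k : 'I_n) : tr k.+1 = tr k + h 0 k *: ev k.
  apply/rowP => i; rewrite !mxE /= ltnS leq_eqVlt.
  have [->|ne] := eqVneq i k; first by rewrite ltnn eqxx add0r mulr1.
  by rewrite (negPf (_ : i != k :> nat)) // mulr0 addr0.
(* The norm is the maximum of the coordinates, so dropping coordinates of [h] or shrinking one of
   them cannot leave the region where [U] is known to hold. *)
have trle (k : 'I_n) s : `|s| <= `|h 0 k| -> `|tr k + s *: ev k| <= `|h|.
  move=> hs; apply: normrV_le => // i; rewrite !mxE /=.
  have [->|ne] := eqVneq i k.
    by rewrite ltnn mulr1 add0r (le_trans hs) // norm_coord_le.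
  by rewrite mulr0 addr0; case: ifP; rewrite ?normr0 // norm_coord_le.
have step (k : 'I_n) : exists y, `|y - x| <= `|h| /\
    F (x + tr k.+1) - F (x + tr k) = h 0 k * pd k F y.
  have [s hs E] : exists2 s : R, `|s| <= `|h 0 k| &
      F (x + tr k + h 0 k *: ev k) - F (x + tr k) =
      h 0 k * 'D_(ev k) F (x + tr k + s *: ev k).
    apply: MVT_line => s hs; apply: (smooth_derivable k sF); apply: hU.
    by rewrite [X in `|X|]addrC -addrA addKr trle.
  exists (x + tr k + s *: ev k); rewrite trS addrA E; split => //.
  by rewrite [X in `|X|]addrC -addrA addKr trle.
have [xi Hxi] := choice step; exists xi; split => [k|]; first by have [] := Hxi k.
rewrite -(eq_bigr _ (fun k _ => (Hxi k).2)).
rewrite -(big_mkord xpredT (fun k => F (x + tr k.+1) - F (x + tr k))).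
rewrite telescope_sumr //; congr (F (x + _) - F _).
  by apply/rowP => i; rewrite mxE ltn_ord.
by apply/rowP => i; rewrite !mxE addr0.
Qed.

(** The increment of [F] is a sum of coordinate increments times partial derivatives at intermediate
    points. Those points tend to [phi u], and continuity of the partial derivatives finishes. Only
    the directional derivative of [phi] enters. *)
Lemma is_derive_chain {R : realType} {n} {U : set 'rV[R]_n} {F}
    {V : normedModType R} (phi : V -> 'rV[R]_n) (u v : V) :
  open U -> smooth_on U F -> U (phi u) -> derivable phi u v ->
  is_derive u v (fun y => F (phi y)) (\sum_i 'D_v phi u 0 i * pd i F (phi u)).
Proof.
move=> oU sF Ux dphi; set x := phi u.
have [r /= r0 rU] := (nbhs_ballP x U).1 (open_nbhs_nbhs (conj oU Ux)).
pose D h := phi (h *: v + u) - x.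
have D0 : D h @[h --> (0:R)] --> (0 : 'rV[R]_n).
  have /derivable1P/derivable1_diffP/differentiable_continuous c := dphi.
  have : (phi (h *: v + u) - x) @[h --> (0:R)] --> (phi (0 *: v + u) - x).
    by apply: cvgB; [exact: c|exact: cvg_cst].
  by rewrite scale0r add0r subrr.
have D0' : D h @[h --> (0:R)^'] --> (0 : 'rV[R]_n).
  by apply: cvg_trans D0; apply: cvg_app; exact: nbhs_dnbhs.
(* The smallness condition is put under the existential so that [choice] gives a total function. For
   large increments the constant [x] is a dummy value. *)
have step h : exists xi : 'I_n -> 'rV[R]_n, `|D h| < r ->
    (forall k, `|xi k - x| <= `|D h|) /\
    F (phi (h *: v + u)) - F x = \sum_k D h 0 k * pd k F (xi k).
  have [Dr|] := ltP `|D h| r; last by exists (fun=> x).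
  have [|xi [xi1 xi2]] := @coordinate_increments _ _ U F x (D h) sF.
    by move=> y hy; apply: rU; rewrite -ball_normE /= distrC (le_lt_trans hy).
  by exists xi => _; split => //; rewrite -xi2 (addrC x) subrK.
have [xi Hxi] := choice step.
have nearD : \forall h \near (0:R)^', `|D h| < r.
  have /cvgr0Pnorm_lt := D0'; exact.
have xix k : xi h k @[h --> (0:R)^'] --> x.
  apply/cvgrPdist_lt => e e0; have /cvgr0Pnorm_lt/(_ _ e0) De := D0'.
  near=> h; rewrite distrC; apply: (@le_lt_trans _ _ `|D h|); last by near: h.
  by have [] := Hxi h; [near: h|move=> + _; apply].
have lim : h^-1 *: (F (phi (h *: v + u)) - F x) @[h --> (0:R)^'] -->
    \sum_i 'D_v phi u 0 i * pd i F x.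
  have nE : \forall h \near (0:R)^',
      \sum_i (h^-1 *: D h) 0 i * pd i F (xi h i) = h^-1 *: (F (phi (h *: v + u)) - F x).
    near=> h; have [|_ ->] := Hxi h; first by near: h.
    rewrite scaler_sumr; apply: eq_bigr => i _.
    by rewrite mxE -mulrA.
  apply: cvg_trans (near_eq_cvg nE) _.
  apply: cvg_big => [|i _]; first exact: add_continuous.
  apply: cvgM.
    have c : h^-1 *: D h @[h --> (0:R)^'] --> 'D_v phi u by exact: dphi.
    exact: (cvg_comp _ (fun M : 'rV[R]_n => M 0 i) c (@coord_continuous _ _ _ 0 i _)).
  have c : {for x, continuous (pd i F)} by exact: smooth_continuous (smooth_pd i sF) Ux.
  exact: (cvg_comp _ _ (xix i) c).
by split; [apply/cvg_ex; eexists; exact: lim|apply/cvg_lim].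
Unshelve. all: by end_near. Qed.

(** * The curvature tensor in terms of Christoffel symbols of the first kind *)

Lemma is_derive_bigsum {R : realType} {V : normedModType R} {I : Type} (r : seq I)
    (F : I -> V -> R) (dF : I -> R) (x v : V) :
  (forall i, is_derive x v (F i) (dF i)) ->
  is_derive x v (fun y => \sum_(i <- r) F i y) (\sum_(i <- r) dF i).
Proof.
move=> h; elim: r => [|i r IH].
  rewrite big_nil; under eq_fun do rewrite big_nil.
  exact: is_derive_cst.
rewrite big_cons; under eq_fun do rewrite big_cons.
exact: is_deriveD.
Qed.

Lemma derivable_bigsum {R : realType} {V : normedModType R} {I : Type} (r : seq I)
    (F : I -> V -> R) (x v : V) :
  (forall i, derivable (F i) x v) -> derivable (fun y => \sum_(i <- r) F i y) x v.
Proof.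
by move=> h; have [] := is_derive_bigsum r F _ x v (fun i => derivableP (h i)).
Qed.

Lemma is_derive_mul {R : realType} {V : normedModType R} {f g : V -> R} {x v : V} {df dg : R} :
  is_derive x v f df -> is_derive x v g dg ->
  is_derive x v (fun y => f y * g y) (df * g x + f x * dg).
Proof.
move=> h k; apply: is_derive_eq (is_deriveM h k) _.
by rewrite addrC /GRing.scale /= (mulrC df).
Qed.

Lemma derivable_bigprod {R : realType} {V : normedModType R} {I : Type} (r : seq I)
    (F : I -> V -> R) (x v : V) :
  (forall i, derivable (F i) x v) -> derivable (fun y => \prod_(i <- r) F i y) x v.
Proof.
move=> h; elim: r => [|i r IH].
  under eq_fun do rewrite big_nil.
  exact: derivable_cst.
under eq_fun do rewrite big_cons.
exact: derivableM.
Qed.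

Lemma derivable_det {R : realType} {V : normedModType R} {n} (M : V -> 'M[R]_n) (x v : V) :
  (forall a b, derivable (fun y => M y a b) x v) ->
  derivable (fun y => \det (M y)) x v.
Proof.
move=> h; rewrite /determinant.
apply: derivable_bigsum => s; apply: derivableM; first exact: derivable_cst.
exact: derivable_bigprod.
Qed.

(** Cramer's rule turns each entry into a cofactor divided by the determinant. The formula holds
    only where the matrix is invertible, as [invmx] returns its argument elsewhere; hence the
    hypothesis on a neighbourhood. *)
Lemma derivable_invmx {R : realType} {V : normedModType R} {n} (M : V -> 'M[R]_n) (x v : V) a b :
  (\forall y \near x, M y \in unitmx) ->
  (forall a b, derivable (fun y => M y a b) x v) ->
  derivable (fun y => invmx (M y) a b) x v.
Proof.
move=> u h.
have E : \forall y \near x, (\det (M y))^-1 * cofactor (M y) b a = invmx (M y) a b.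
  by near=> y; rewrite /invmx ifT ?mxE //; near: y.
apply: near_eq_derivable E _; apply: derivableM.
  apply: derivableV; last exact: derivable_det.
  by have := nbhs_singleton u; rewrite unitmxE unitfE.
apply: derivableM; first exact: derivable_cst.
apply: derivable_det => i j; under eq_fun do rewrite !mxE.
exact: h.
Unshelve. all: by end_near. Qed.

(** The lowered index comes first. No inverse of the metric occurs, so differentiating these symbols
    only involves entries of [G]. *)
Definition christoffel1 {R : realType} {n} (G : 'rV[R]_n -> 'M[R]_n) (m j k : 'I_n)
    (x : 'rV[R]_n) : R :=
  2^-1 * (pd j (fun y => G y k m) x + pd k (fun y => G y j m) x
     - pd m (fun y => G y j k) x).

Lemma GammaE {R : realType} {n} (G : 'rV[R]_n -> 'M[R]_n) l j k x :
  Gamma G l j k x = \sum_p invmx (G x) l p * christoffel1 G p j k x.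
Proof.
rewrite /Gamma mulr_sumr; apply: eq_bigr => p _.
by rewrite /christoffel1 mulrCA.
Qed.

Lemma Gamma_lower {R : realType} {n} (G : 'rV[R]_n -> 'M[R]_n) m j k x :
  (G x)^T = G x -> G x \in unitmx ->
  \sum_l Gamma G l j k x * G x l m = christoffel1 G m j k x.
Proof.
move=> sG uG.
under eq_bigr do rewrite GammaE mulr_suml.
rewrite exchange_big /= (eq_bigr (fun p => (G x *m invmx (G x)) m p * christoffel1 G p j k x)).
  rewrite mulmxV // (bigD1 m) //= mxE eqxx mul1r big1 ?addr0 // => p /negPf ne.
  by rewrite mxE eq_sym ne mul0r.
move=> p _; rewrite mxE mulr_suml; apply: eq_bigr => l _.
have -> : G x l m = G x m l by rewrite -{1}sG mxE.
ring.
Qed.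

(** Lowering the index under the derivative sign produces derivatives of the metric. By metric
    compatibility each splits into two symbols of the first kind; one half cancels the quadratic
    terms of [Riem], the other half is what remains. *)
Lemma Rm_christoffel {R : realType} {n} (G : 'rV[R]_n -> 'M[R]_n) x i j k m :
  (\forall y \near x, (G y)^T = G y) -> (\forall y \near x, G y \in unitmx) ->
  (forall i a b, derivable (fun y => G y a b) x (ev i)) ->
  (forall i m j k, derivable (christoffel1 G m j k) x (ev i)) ->
  Rm G i j k m x = pd i (christoffel1 G m j k) x - pd j (christoffel1 G m i k) x
    - \sum_l Gamma G l j k x * christoffel1 G l i m x
    + \sum_l Gamma G l i k x * christoffel1 G l j m x.
Proof.
move=> sG uG dG dC.
have sG' a b : \forall y \near x, G y a b = G y b a.
  near=> y; have e : (G y)^T = G y by near: y.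
  by rewrite -[in LHS]e mxE.
have sx := nbhs_singleton sG; have ux := nbhs_singleton uG.
have dGam c l a b : derivable (Gamma G l a b) x (ev c).
  have -> : Gamma G l a b = fun y => \sum_p invmx (G y) l p * christoffel1 G p a b y.
    by apply/funext => y; rewrite GammaE.
  apply: derivable_bigsum => p.
  by apply: derivableM => //; apply: derivable_invmx.
(* Compatibility of the Levi-Civita connection with the metric. *)
have pdG c a b : pd c (fun y => G y a b) x = christoffel1 G b c a x + christoffel1 G a c b x.
  have e a' b' c' : pd c' (fun y => G y a' b') x = pd c' (fun y => G y b' a') x.
    exact: near_eq_derive.
  by rewrite /christoffel1 (e b a); field.
(* The product rule for the lowering identity [Gamma_lower], which holds near [x]. It trades
   derivatives of [Gamma], hence of the inverse metric, for derivatives of the lowered symbols. *)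
have low c a b e : \sum_l pd c (Gamma G l a b) x * G x l e =
    pd c (christoffel1 G e a b) x - \sum_l Gamma G l a b x * pd c (fun y => G y l e) x.
  have E : \forall y \near x, \sum_l Gamma G l a b y * G y l e = christoffel1 G e a b y.
    near=> y; apply: Gamma_lower; near: y; [exact: sG|exact: uG].
  have <- : 'D_(ev c) (fun y => \sum_l Gamma G l a b y * G y l e) x = pd c (christoffel1 G e a b) x.
    exact: near_eq_derive.
  have D : is_derive x (ev c) (fun y => \sum_l Gamma G l a b y * G y l e)
     (\sum_l (pd c (Gamma G l a b) x * G x l e + Gamma G l a b x * pd c (fun y => G y l e) x)).
    apply: is_derive_bigsum => l.
    by apply: is_derive_mul; apply: derivableP.
  by rewrite (@derive_val _ _ _ _ _ _ _ D) big_split /= addrK.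
have quad a b c : \sum_l (\sum_p Gamma G l a p x * Gamma G p b c x) * G x l m =
    \sum_l Gamma G l b c x * christoffel1 G m a l x.
  under eq_bigr do rewrite mulr_suml.
  rewrite exchange_big /=; apply: eq_bigr => p _.
  rewrite -(Gamma_lower G m a p x sx ux) mulr_sumr; apply: eq_bigr => l _.
  by rewrite mulrAC mulrC.
rewrite /Rm /Riem.
under eq_bigr do rewrite sumrB mulrDl !mulrBl.
have split a b c : \sum_l Gamma G l b c x * pd a (fun y => G y l m) x =
   \sum_l Gamma G l b c x * christoffel1 G m a l x + \sum_l Gamma G l b c x * christoffel1 G l a m x.
  by rewrite -big_split /=; apply: eq_bigr => l _; rewrite pdG mulrDr.
rewrite big_split sumrB sumrB.
transitivity (pd i (christoffel1 G m j k) x - \sum_l Gamma G l j k x * pd i (fun y => G y l m) x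
  - (pd j (christoffel1 G m i k) x - \sum_l Gamma G l i k x * pd j (fun y => G y l m) x)
  + (\sum_l Gamma G l j k x * christoffel1 G m i l x
     - \sum_l Gamma G l i k x * christoffel1 G m j l x)).
  by congr (_ - _ + (_ - _)); [exact: low|exact: low|exact: quad|exact: quad].
rewrite (split i j k) (split j i k).
have alg (A B q1 q2 s1 s2 : R) : A - (q1 + s1) - (B - (q2 + s2)) + (q1 - q2) = A - B - s1 + s2.
  by ring.
exact: alg.
Unshelve. all: by end_near. Qed.

(** * The Clebsch form of a ternary cubic *)

Definition sym_bilinear {R : realType} {V : lmodType R} (g : V -> V -> R) :=
  (forall u v, g u v = g v u) /\
  (forall a u u' v, g (a *: u + u') v = a * g u v + g u' v).

Definition sym_trilinear {R : realType} {V : lmodType R} (t : V -> V -> V -> R) :=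
  [/\ (forall u v w, t u v w = t v u w), (forall u v w, t u v w = t u w v) &
      (forall a u u' v w, t (a *: u + u') v w = a * t u v w + t u' v w)].

Definition clebsch_poly {R : realType} (a0 a1 a2 a3 b0 b1 b2 c0 c1 d0 : R) : R :=
  - (a0 * a2 - a1 ^+ 2) * c1 ^+ 2 + (a0 * a3 - a1 * a2) * c0 * c1
  - (a1 * a3 - a2 ^+ 2) * c0 ^+ 2 - b0 ^+ 2 * a3 * c1
  + b0 * b1 * (3 * a2 * c1 + a3 * c0)
  - (b0 * b2 + 2 * b1 ^+ 2) * (a1 * c1 + a2 * c0)
  + b1 * b2 * (a0 * c1 + 3 * a1 * c0) - b2 ^+ 2 * a0 * c0
  + d0 * (b0 * (a1 * a3 - a2 ^+ 2) - b1 * (a0 * a3 - a1 * a2)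
          + b2 * (a0 * a2 - a1 ^+ 2))
  + (b0 * b2 - b1 ^+ 2) ^+ 2.

(** In the coefficient names the letter counts the occurrences of [v] (a for none, d for three) and
    the digit counts the occurrences of [w]. *)
Definition clebsch_form {R : realType} {V : lmodType R} (t : V -> V -> V -> R) (u v w : V) : R :=
  clebsch_poly (t u u u) (t u u w) (t u w w) (t w w w) (t u u v) (t u v w) (t v w w)
    (t u v v) (t v v w) (t v v v).

Section ClebschForm.
Variables (R : realType) (V : lmodType R) (t : V -> V -> V -> R).
Hypothesis ht : sym_trilinear t.

Let s12 u v w : t u v w = t v u w. Proof. by case: ht. Qed.
Let s23 u v w : t u v w = t u w v. Proof. by case: ht. Qed.
Let lin1 a u u' v w : t (a *: u + u') v w = a * t u v w + t u' v w.
Proof. by case: ht. Qed.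
Let lin2 a u u' v w : t v (a *: u + u') w = a * t v u w + t v u' w.
Proof. by rewrite s12 lin1 (s12 u) (s12 u'). Qed.
Let lin3 a u u' v w : t v w (a *: u + u') = a * t v w u + t v w u'.
Proof. by rewrite s23 lin2 (s23 v u) (s23 v u'). Qed.
Let t0 v w : t 0 v w = 0.
Proof. by have := lin1 1 0 0 v w; rewrite scaler0 addr0 mul1r; lra. Qed.
Let scale1 a u v w : t (a *: u) v w = a * t u v w.
Proof. by rewrite -[a *: u]addr0 lin1 t0 addr0. Qed.
Let scale2 a u v w : t v (a *: u) w = a * t v u w.
Proof. by rewrite s12 scale1 s12. Qed.
Let scale3 a u v w : t v w (a *: u) = a * t v w u.
Proof. by rewrite s23 scale2 s23. Qed.

(** Rewrite rules that sort the arguments of [t] into the order [u], [v], [w]. Identities between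
    Clebsch forms then become polynomial identities in ten components, within reach of [ring]. *)
Let canon u v w :
  (t u v u = t u u v) * (t v u u = t u u v) * (t u w u = t u u w) * (t w u u = t u u w)
  * (t v u v = t u v v) * (t v v u = t u v v) * (t w u w = t u w w) * (t w w u = t u w w)
  * (t v w v = t v v w) * (t w v v = t v v w) * (t w v w = t v w w) * (t w w v = t v w w)
  * (t u w v = t u v w) * (t v u w = t u v w) * (t v w u = t u v w) * (t w u v = t u v w)
  * (t w v u = t u v w).
Proof.
have A a b : (t a b a = t a a b) * (t b a a = t a a b).
  by split; [rewrite s23|rewrite s12 s23].
have B1 : t u w v = t u v w by rewrite s23.
have B2 : t v u w = t u v w by rewrite s12.
have B3 : t v w u = t u v w by rewrite s23 s12.
have B4 : t w u v = t u v w by rewrite s12 s23.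
have B5 : t w v u = t u v w by rewrite s12 B3.
by do ![split]; rewrite ?A ?B1 ?B2 ?B3 ?B4 ?B5.
Qed.

Lemma clebsch_form_swap12 u v w : clebsch_form t v u w = clebsch_form t u v w.
Proof. rewrite /clebsch_form !(canon u v w) /clebsch_poly; ring. Qed.

Lemma clebsch_form_swap23 u v w : clebsch_form t u w v = clebsch_form t u v w.
Proof. rewrite /clebsch_form !(canon u v w) /clebsch_poly; ring. Qed.

(** The one shear checked by full expansion; the other shears are conjugate to it under the two
    swaps. *)
Lemma clebsch_form_shear12 a u v w : clebsch_form t u (a *: u + v) w = clebsch_form t u v w.
Proof.
rewrite /clebsch_form !(lin1, lin2, lin3) !(canon u v w) /clebsch_poly; ring.
Qed.

(** Every monomial of the quartic has twelve indices, four of each kind; this is the weight 4. *)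
Lemma clebsch_form_scale1 a u v w : clebsch_form t (a *: u) v w = a ^+ 4 * clebsch_form t u v w.
Proof.
rewrite /clebsch_form !(scale1, scale2, scale3) /clebsch_poly; ring.
Qed.

Lemma clebsch_form_shear13 a u v w : clebsch_form t u v (a *: u + w) = clebsch_form t u v w.
Proof. by rewrite -clebsch_form_swap23 clebsch_form_shear12 clebsch_form_swap23. Qed.

Lemma clebsch_form_shear23 a u v w : clebsch_form t u v (a *: v + w) = clebsch_form t u v w.
Proof. by rewrite -clebsch_form_swap12 clebsch_form_shear13 clebsch_form_swap12. Qed.

Lemma clebsch_form_shear21 a u v w : clebsch_form t (a *: v + u) v w = clebsch_form t u v w.
Proof. by rewrite -clebsch_form_swap12 clebsch_form_shear12 clebsch_form_swap12. Qed.

Lemma clebsch_form_shear32 a u v w : clebsch_form t u (a *: w + v) w = clebsch_form t u v w.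
Proof. by rewrite -clebsch_form_swap23 clebsch_form_shear23 clebsch_form_swap23. Qed.

Lemma clebsch_form_shear31 a u v w : clebsch_form t (a *: w + u) v w = clebsch_form t u v w.
Proof. by rewrite -clebsch_form_swap12 clebsch_form_shear32 clebsch_form_swap12. Qed.

Lemma clebsch_form_scale2 a u v w : clebsch_form t u (a *: v) w = a ^+ 4 * clebsch_form t u v w.
Proof. by rewrite -clebsch_form_swap12 clebsch_form_scale1 clebsch_form_swap12. Qed.

Lemma clebsch_form_scale3 a u v w : clebsch_form t u v (a *: w) = a ^+ 4 * clebsch_form t u v w.
Proof. by rewrite -clebsch_form_swap23 clebsch_form_scale2 clebsch_form_swap23. Qed.
End ClebschForm.

Definition rows3 {R : realType} {T} (Q : 'rV[R]_3 -> 'rV[R]_3 -> 'rV[R]_3 -> T) (M : 'M[R]_3) : T :=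
  Q (row o0 M) (row o1 M) (row o2 M).

Lemma ord3P (P : 'I_3 -> Prop) : P o0 -> P o1 -> P o2 -> forall i, P i.
Proof.
move=> h0 h1 h2 [[|[|[|//]]] Hi].
- by rewrite (_ : Ordinal Hi = o0) //; apply: val_inj.
- by rewrite (_ : Ordinal Hi = o1) //; apply: val_inj.
- by rewrite (_ : Ordinal Hi = o2) //; apply: val_inj.
Qed.

Lemma sum3E {R : realType} (F : 'I_3 -> R) : \sum_i F i = F o0 + F o1 + F o2.
Proof.
rewrite !big_ord_recl big_ord0 addr0 addrA.
by congr (F _ + F _ + F _); apply: val_inj.
Qed.

Lemma row3E {R : realType} (x : 'rV[R]_3) :
  x = x 0 o0 *: ev o0 + (x 0 o1 *: ev o1 + x 0 o2 *: ev o2).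
Proof.
apply/rowP; apply: ord3P; rewrite !mxE /=; ring.
Qed.

(** In P M = L W, the permutation acts by swaps, the unit lower triangular factor by shears, and the
    upper triangular factor by shears and by scalings with its diagonal entries. The sign of the
    permutation disappears in the fourth power. *)
Lemma clebsch_form_det {R : realType} (t : 'rV[R]_3 -> 'rV[R]_3 -> 'rV[R]_3 -> R) (M : 'M[R]_3) :
  sym_trilinear t ->
  rows3 (clebsch_form t) M = \det M ^+ 4 * clebsch_form t (ev o0) (ev o1) (ev o2).
Proof.
move=> ht; set Q := clebsch_form t.
have [P [L [W [[s Ps] PM dL hL hW]]]] : exists P L W : 'M[R]_3,
    [/\ exists s, P = perm_mx s, P *m M = L *m W, \det L = 1,
      forall i j : 'I_3, (i <= j)%N -> L i j = (i == j)%:R &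
      forall i j : 'I_3, (j < i)%N -> W i j = 0].
  exists (cormen_lup M).1.1, (cormen_lup M).1.2, (cormen_lup M).2; split.
  - exact/is_perm_mxP/cormen_lup_perm.
  - by case: (cormen_lup M) (cormen_lup_correct M) => [[P L] W].
  - exact: cormen_lup_detL.
  - by move=> i j; apply: cormen_lup_lower.
  - by move=> i j; apply: cormen_lup_upper.
have rPM i : row i (P *m M) = row (s i) M.
  by rewrite Ps -row_permE; apply/rowP => j; rewrite !mxE.
have permQ : rows3 Q (P *m M) = rows3 Q M.
  rewrite /rows3 !rPM.
  have inj a b : a != b -> s a != s b by apply: contra => /eqP /perm_inj ->.
  have := inj o0 o1 isT; have := inj o0 o2 isT; have := inj o1 o2 isT.
  rewrite /Q.
  (* Injectivity of [s] leaves six of the 27 triples of images. The identity is immediate; the other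
     five are products of the two swaps. *)
  elim/ord3P : (s o0); elim/ord3P : (s o1); elim/ord3P : (s o2) => // _ _ _.
  - by rewrite clebsch_form_swap23.
  - by rewrite clebsch_form_swap12.
  - by rewrite clebsch_form_swap23 // clebsch_form_swap12.
  - by rewrite clebsch_form_swap12 // clebsch_form_swap23.
  - by rewrite clebsch_form_swap12 // clebsch_form_swap23 // clebsch_form_swap12.
have rLW i : row i (L *m W) = L i o0 *: row o0 W + (L i o1 *: row o1 W + L i o2 *: row o2 W).
  by apply/rowP => j; rewrite !mxE sum3E addrA.
have lowQ : rows3 Q (L *m W) = rows3 Q W.
  have [l00 l11 l22] : [/\ L o0 o0 = 1, L o1 o1 = 1 & L o2 o2 = 1] by split; rewrite hL.
  have [l01 l02 l12] : [/\ L o0 o1 = 0, L o0 o2 = 0 & L o1 o2 = 0] by split; rewrite hL.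
  rewrite /rows3 !rLW l00 l11 l22 l01 l02 l12 !scale0r !scale1r !addr0.
  by rewrite /Q clebsch_form_shear13 // clebsch_form_shear12 // clebsch_form_shear23.
have upQ : rows3 Q W = \det W ^+ 4 * Q (ev o0) (ev o1) (ev o2).
  have rW i : row i W = W i o0 *: ev o0 + (W i o1 *: ev o1 + W i o2 *: ev o2).
    by rewrite {1}(row3E (row i W)) ![row i W _ _]mxE.
  rewrite /rows3 !rW (hW o2 o0) // (hW o2 o1) // (hW o1 o0) // !scale0r !add0r.
  (* Back substitution from the last row: once a row is reduced to a basis vector, it clears its
     column in the rows above. *)
  rewrite /Q clebsch_form_scale3 //.
  rewrite [X in clebsch_form t _ X _]addrC clebsch_form_shear32 // clebsch_form_scale2 //.
  rewrite [X in clebsch_form t X _ _]addrC -addrA clebsch_form_shear21 // clebsch_form_shear31 //.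
  rewrite clebsch_form_scale1 // -det_tr (det_trig (_ : is_trig_mx W^T)); last first.
    by apply/is_trig_mxP => i j ij; rewrite mxE hW.
  rewrite !big_ord_recl big_ord0 !mxE.
  have -> : lift ord0 (ord0 : 'I_2) = o1 by apply: val_inj.
  have -> : lift ord0 (lift ord0 (ord0 : 'I_1)) = o2 by apply: val_inj.
  have -> : ord0 = o0 by apply: val_inj.
  ring.
rewrite -permQ PM lowQ upQ; congr (_ * _).
have := congr1 determinant PM; rewrite !det_mulmx dL mul1r => <-.
rewrite Ps det_perm.
by case: (odd_perm s); rewrite ?expr1 ?expr0; ring.
Qed.

(** * Bilinear forms, Gram determinants and the Clebsch form in an adapted basis *)

(** Convertible with [bil] at a point. Detaching the matrix from the point allows it to vary
    independently of the chart, as with [hess f (phi y)]. *)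
Definition qf {R : realType} {n} (M : 'M[R]_n) (v w : 'rV[R]_n) : R :=
  \sum_(i < n) \sum_(j < n) v 0 i * M i j * w 0 j.

Lemma qfE {R : realType} {n} (M : 'M[R]_n) v w : qf M v w = (v *m M *m w^T) 0 0.
Proof.
rewrite /qf exchange_big mxE; apply: eq_bigr => j _.
by rewrite !mxE mulr_suml.
Qed.

Lemma qf_sym_bilinear {R : realType} {n} (M : 'M[R]_n) :
  M^T = M -> sym_bilinear (qf M).
Proof.
move=> sM; split=> [v w|a u u' v]; rewrite !qfE.
  by rewrite -[in LHS](trmxK (v *m M *m w^T)) mxE !trmx_mul trmxK sM mulmxA.
by rewrite !mulmxDl -!scalemxAl !mxE.
Qed.

Section BilinearTheory.
Context {R : realType} {V : lmodType R} {g : V -> V -> R}.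
Hypothesis hg : sym_bilinear g.

Lemma bilC u v : g u v = g v u. Proof. by case: hg. Qed.
Lemma bil0l v : g 0 v = 0.
Proof. by case: hg => _ /(_ 1 0 0 v); rewrite scaler0 addr0 mul1r; lra. Qed.
Lemma bilDl u u' v : g (u + u') v = g u v + g u' v.
Proof. by case: hg => _ /(_ 1 u u' v); rewrite scale1r mul1r. Qed.
Lemma bilZl a u v : g (a *: u) v = a * g u v.
Proof. by case: hg => _ /(_ a u 0 v); rewrite bil0l !addr0. Qed.
Lemma bilDr u u' v : g v (u + u') = g v u + g v u'.
Proof. by rewrite bilC bilDl !(bilC _ v). Qed.
Lemma bilZr a u v : g v (a *: u) = a * g v u.
Proof. by rewrite bilC bilZl bilC. Qed.
End BilinearTheory.

Definition mat3 {R : realType} (x v w : 'rV[R]_3) : 'M[R]_3 :=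
  \matrix_(i, j) (if i == o0 then x 0 j else if i == o1 then v 0 j else w 0 j).

Lemma row_mat3 {R : realType} (x v w : 'rV[R]_3) :
  [/\ row o0 (mat3 x v w) = x, row o1 (mat3 x v w) = v & row o2 (mat3 x v w) = w].
Proof. by split; apply/rowP => j; rewrite !mxE. Qed.

Lemma mat3_basis {R : realType} (x v w : 'rV[R]_3) :
  mat3 x v w \in unitmx ->
  forall a, exists al be ga : R, a = al *: x + be *: v + ga *: w.
Proof.
move=> uB a; pose c := a *m invmx (mat3 x v w).
exists (c 0 o0), (c 0 o1), (c 0 o2); rewrite -[LHS](mulmxKV uB) -/c.
by apply/rowP => j; rewrite !mxE sum3E !mxE.
Qed.

(* The two terms are the inner products of the components along x and of the projections
   to the plane spanned by v and w. *)
Lemma orthogonal_expansion {R : realType} (g : 'rV[R]_3 -> 'rV[R]_3 -> R) (x v w a b : 'rV[R]_3) :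
  sym_bilinear g -> mat3 x v w \in unitmx ->
  g x v = 0 -> g x w = 0 -> g x x != 0 -> g v v * g w w - g v w ^+ 2 != 0 ->
  g a b = g a x * g b x / g x x
    + (g w w * (g a v * g b v) - g v w * (g a v * g b w + g a w * g b v)
       + g v v * (g a w * g b w)) / (g v v * g w w - g v w ^+ 2).
Proof.
move=> hg uB xv xw xx D0.
have [a0 [a1 [a2 ->]]] := mat3_basis x v w uB a.
have [b0 [b1 [b2 ->]]] := mat3_basis x v w uB b.
rewrite !(bilDl hg, bilZl hg) !(bilDr hg, bilZr hg) (bilC hg v x) (bilC hg w x) (bilC hg w v) xv xw.
move: D0 xx; set X := g x x; set vv := g v v; set vw := g v w; set ww := g w w => D0 xx.
by field; rewrite D0 xx.
Qed.

Lemma det2E {R : realType} (M : 'M[R]_2) : \det M = M 0 0 * M 1 1 - M 0 1 * M 1 0.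
Proof.
rewrite (expand_det_row _ 0) !big_ord_recl big_ord0 /cofactor !det_mx11 !mxE /=.
have -> : lift (0 : 'I_2) (0 : 'I_1) = 1 by apply: val_inj.
have -> : lift (1 : 'I_2) (0 : 'I_1) = 0 by apply: val_inj.
by rewrite expr0 expr1; ring.
Qed.

Lemma det3E {R : realType} (M : 'M[R]_3) :
  \det M = M o0 o0 * (M o1 o1 * M o2 o2 - M o1 o2 * M o2 o1)
         - M o0 o1 * (M o1 o0 * M o2 o2 - M o1 o2 * M o2 o0)
         + M o0 o2 * (M o1 o0 * M o2 o1 - M o1 o1 * M o2 o0).
Proof.
rewrite (expand_det_row _ o0) sum3E /cofactor !det2E !mxE.
have e0 : lift o0 (0 : 'I_2) = o1 by apply: val_inj.
have e1 : lift o0 (1 : 'I_2) = o2 by apply: val_inj.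
have e2 : lift o1 (0 : 'I_2) = o0 by apply: val_inj.
have e3 : lift o1 (1 : 'I_2) = o2 by apply: val_inj.
have e4 : lift o2 (0 : 'I_2) = o0 by apply: val_inj.
have e5 : lift o2 (1 : 'I_2) = o1 by apply: val_inj.
rewrite e0 e1 e2 e3 e4 e5 /=; ring.
Qed.

(** With B the matrix of rows [x], [v], [w], the Gram matrix of these vectors is B M B^T, and
    orthogonality of [x] to [v] and [w] makes it block diagonal. *)
Lemma det_gram {R : realType} (M : 'M[R]_3) (x v w : 'rV[R]_3) :
  M^T = M -> qf M x v = 0 -> qf M x w = 0 ->
  \det M * \det (mat3 x v w) ^+ 2 = qf M x x * (qf M v v * qf M w w - qf M v w ^+ 2).
Proof.
move=> sM xv xw; have hq := qf_sym_bilinear M sM.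
set B := mat3 x v w.
have E i j : (B *m M *m B^T) i j = qf M (row i B) (row j B).
  rewrite qfE -row_mul mxE [RHS]mxE; apply: eq_bigr => l _.
  by congr (_ * _); [rewrite [RHS]mxE|rewrite !mxE].
have -> : \det M * \det B ^+ 2 = \det (B *m M *m B^T) by rewrite !det_mulmx det_tr; ring.
have [r0 r1 r2] := row_mat3 x v w.
rewrite det3E !E r0 r1 r2 (bilC hq v x) (bilC hq w x) (bilC hq w v) xv xw; ring.
Qed.

(* In a basis x, v, w with v, w tangent, the components t(x,x,v) and t(x,x,w) vanish,
   and the Clebsch form reduces to the curvature numerator. *)
Lemma clebsch_curvature {R : realType} (H : 'M[R]_3) (t : 'rV[R]_3 -> 'rV[R]_3 -> 'rV[R]_3 -> R)
    (x v w avv avw aww : 'rV[R]_3) (k : R) :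
  H^T = H -> sym_trilinear t -> mat3 x v w \in unitmx ->
  (forall y z, t x y z = k * qf H y z) ->
  qf H x v = 0 -> qf H x w = 0 -> \det H != 0 ->
  (forall y, qf H avv y = t v v y) -> (forall y, qf H avw y = t v w y) ->
  (forall y, qf H aww y = t w w y) ->
  clebsch_form t (ev o0) (ev o1) (ev o2) * qf H x x
    * (qf H v v * qf H w w - qf H v w ^+ 2) =
  k ^+ 2 * (qf H avv aww - qf H avw avw) * \det H ^+ 2.
Proof.
move=> sH ht uB tx xv xw H0 Avv Avw Aww.
have hq := qf_sym_bilinear H sH.
have G := det_gram H x v w sH xv xw.
have B0 : \det (mat3 x v w) != 0 by rewrite -unitfE -unitmxE.
have : qf H x x * (qf H v v * qf H w w - qf H v w ^+ 2) != 0.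
  by rewrite -G mulf_neq0 // expf_neq0.
rewrite mulf_eq0 negb_or => /andP[X0 D0].
have E := clebsch_form_det t (mat3 x v w) ht.
have [r0 r1 r2] := row_mat3 x v w; rewrite /rows3 r0 r1 r2 in E.
(* After the expansion the dual vectors are paired only with [x], [v], [w], so N becomes a
   polynomial in components of [t] divided by values of [H]. *)
rewrite (orthogonal_expansion _ x v w avv aww hq uB xv xw X0 D0).
rewrite (orthogonal_expansion _ x v w avw avw hq uB xv xw X0 D0).
have [s12 s23 _] := ht.
rewrite !Avv !Avw !Aww.
have vvx : t v v x = k * qf H v v by rewrite s23 s12 tx.
have vwx : t v w x = k * qf H v w by rewrite s23 s12 tx.
have wwx : t w w x = k * qf H w w by rewrite s23 s12 tx.
have vwv : t v w v = t v v w by rewrite s23.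
have wwv : t w w v = t v w w by rewrite s23 s12.
rewrite vvx vwx wwx vwv wwv.
move: E; set S := clebsch_form t (ev o0) _ _.
rewrite /clebsch_form /clebsch_poly !tx xv xw.
move: G X0 D0 H0 B0.
set detB := \det (mat3 x v w); set detH := \det H.
move: (t v v v) (t v v w) (t v w w) (t w w w) detB detH S (qf H x x) (qf H v v) (qf H v w) (qf H w w).
move=> d0 c1 b2 a3 detB detH S X vv vw ww G X0 D0 H0 B0 E.
have B4 : detB ^+ 4 != 0 by rewrite expf_neq0.
(* The factor [detB ^+ 4] turns [S] into its value in the basis x, v, w by [E], and [detH ^+ 2] into
   the square of [X * (vv * ww - vw ^+ 2)] by [G]. *)
apply: (mulIf B4).
have sq z : z * detH ^+ 2 * detB ^+ 4 = z * (detH * detB ^+ 2) ^+ 2 by ring.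
rewrite sq G.
have -> : S * X * (vv * ww - vw ^+ 2) * detB ^+ 4 = (detB ^+ 4 * S) * (X * (vv * ww - vw ^+ 2)) by ring.
rewrite -E; field; rewrite X0 D0 //.
Qed.

(** * Euler identities *)

Lemma derive_row {R : realType} {V : normedModType R} {n} {phi : V -> 'rV[R]_n} {u v : V} i :
  derivable phi u v -> ('D_v phi u) 0 i = 'D_v (fun y => phi y 0 i) u.
Proof. by move=> d; rewrite (derive_mx d) mxE. Qed.

Lemma is_derive_coord {R : realType} {n} {x v : 'rV[R]_n} i :
  is_derive x v (fun y : 'rV[R]_n => y 0 i) (v 0 i).
Proof.
have d := @derivable_id R 'rV[R]_n x v.
split; first by move/derivable_mxP : d; apply.
by rewrite -(derive_row i d) derive_id.
Qed.

(** Both sides of f(t x) = t^d f(x) are differentiated at t = 1. As [U] is open, [t *: x] stays in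
    [U] for [t] near 1, where homogeneity applies. *)
Lemma euler_identity {R : realType} (U : set 'rV[R]_3) f (d : R) :
  open U -> smooth_on U f -> homogeneous_on U f d ->
  forall x, U x -> \sum_i x 0 i * pd i f x = d * f x.
Proof.
move=> oU sf hom x Ux.
pose phi (t : R) : 'rV[R]_3 := t *: x.
have dphi i : is_derive (1 : R) (1 : R) (fun t => phi t 0 i) (x 0 i).
  have -> : (fun t => phi t 0 i) = (fun t : R => t * x 0 i).
    by apply/funext => t; rewrite mxE.
  have h := is_derive_mul (is_derive_id (1 : R) (1 : R)) (is_derive_cst (x 0 i) (1 : R) (1 : R)).
  by apply: is_derive_eq h _; rewrite mul1r mulr0 addr0.
have dphi1 : derivable phi 1 1.
  by apply/derivable_mxP => a i; rewrite (ord1 a); have [] := dphi i.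
have phi1 : phi 1 = x by rewrite /phi scale1r.
have Uphi : U (phi 1) by rewrite phi1.
have D1 := is_derive_chain phi 1 1 oU sf Uphi dphi1.
have cphi : {for (1 : R), continuous phi}.
  exact/differentiable_continuous/derivable1_diffP.
have nU : \forall t \near (1 : R), U (phi t).
  by apply: cphi; exact: open_nbhs_nbhs.
have D2 : is_derive (1 : R) (1 : R) (fun t => f (phi t)) (d * f x).
  apply: (@near_eq_is_derive _ _ _ (fun t : R => t `^ d * f x)).
    near=> t; rewrite [RHS]hom //; first by near: t; exact: lt_nbhsr.
    by near: t.
  have h := is_derive_mul (is_derive1_powR d (@ltr01 R)) (is_derive_cst (f x) (1 : R) (1 : R)).
  by apply: is_derive_eq h _; rewrite powR1 mulr1 mulr0 addr0.
rewrite -(@derive_val _ _ _ _ _ _ _ D2) (@derive_val _ _ _ _ _ _ _ D1) phi1.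
apply: eq_bigr => i _; rewrite (derive_row i dphi1).
by rewrite (@derive_val _ _ _ _ _ _ _ (dphi i)).
Unshelve. all: by end_near. Qed.

Lemma near_open {R : realType} {n} {U : set 'rV[R]_n} {x} {P : 'rV[R]_n -> Prop} :
  open U -> U x -> (forall y, U y -> P y) -> \forall y \near x, P y.
Proof. by move=> oU Ux h; apply: filterS h _; exact: open_nbhs_nbhs. Qed.

(** Differentiating Euler's relation in direction [j] yields one extra copy of [pd j F], so the
    degree drops by one. Stated for an arbitrary [F] and [k] so that it can be iterated up to third
    derivatives. *)
Lemma euler_pd {R : realType} {n} (U : set 'rV[R]_n) F (k : R) :
  open U -> smooth_on U F ->
  (forall x, U x -> \sum_i x 0 i * pd i F x = k * F x) ->
  forall j x, U x -> \sum_i x 0 i * pd i (pd j F) x = (k - 1) * pd j F x.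
Proof.
move=> oU sF eul j x Ux.
have D1 : is_derive x (ev j) (fun y => \sum_i y 0 i * pd i F y)
    (\sum_i (ev j 0 i * pd i F x + x 0 i * pd j (pd i F) x)).
  apply: is_derive_bigsum => i; apply: is_derive_mul; first exact: is_derive_coord.
  exact/derivableP/(smooth_derivable j (smooth_pd i sF)).
have D2 : is_derive x (ev j) (fun y => k * F y) (k * pd j F x).
  have h := is_derive_mul (is_derive_cst k x (ev j)) (derivableP (smooth_derivable j sF Ux)).
  by apply: is_derive_eq h _; rewrite mul0r add0r.
have E : pd j (fun y => \sum_i y 0 i * pd i F y) x = pd j (fun y => k * F y) x.
  by apply: near_eq_derive; exact: near_open oU Ux eul.
move: E; rewrite /pd (@derive_val _ _ _ _ _ _ _ D1) (@derive_val _ _ _ _ _ _ _ D2) -!/(pd _ _).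
rewrite big_split /= (bigD1 j) //= big1 => [|i /negPf ne]; last by rewrite mxE ne mul0r.
rewrite mxE !eqxx mul1r addr0 => E.
rewrite (eq_bigr (fun i => x 0 i * pd j (pd i F) x)); last first.
  by move=> i _; rewrite (pdC U) .
move: E; set S := \sum_i _; rewrite /pd; move: (derive _ _ _) S => a S; lra.
Qed.

Section Hessian.
Context {R : realType} {U : set 'rV[R]_3} {f : 'rV[R]_3 -> R}.
Hypotheses (oU : open U) (sf : smooth_on U f).

Lemma hess_sym x : U x -> (hess f x)^T = hess f x.
Proof. by move=> Ux; apply/matrixP => i j; rewrite !mxE (pdC U). Qed.

Lemma f3_swap12 i j k x : U x -> f3 f i j k x = f3 f j i k x.
Proof. by move=> Ux; apply: (pdC U _ _ _ _ oU (smooth_pd k sf) Ux). Qed.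

(** The symmetry of the inner second derivatives is itself differentiated, so it has to hold on a
    neighbourhood of [x]. *)
Lemma f3_swap23 i j k x : U x -> f3 f i j k x = f3 f i k j x.
Proof.
move=> Ux.
have h : \forall y \near x, pd j (pd k f) y = pd k (pd j f) y.
  by apply: (near_open oU Ux) => y Uy; apply: (pdC U).
exact: (near_eq_derive (ev i) h).
Qed.

Lemma smooth_f3 i j k : smooth_on U (f3 f i j k).
Proof. exact: (smooth_pd i (smooth_pd j (smooth_pd k sf))). Qed.

Lemma smooth_hess i j : smooth_on U (fun y => hess f y i j).
Proof.
have -> : (fun y => hess f y i j) = pd i (pd j f) by apply/funext => y; rewrite mxE.
exact: (smooth_pd i (smooth_pd j sf)).
Qed.

Lemma pd_hess k i j x : pd k (fun y => hess f y i j) x = f3 f k i j x.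
Proof. by rewrite /f3; congr (pd _ _ _); apply/funext => y; rewrite mxE. Qed.

Lemma pd_f3_sym12 i j k l x : U x -> pd i (f3 f j k l) x = pd j (f3 f i k l) x.
Proof. by move=> Ux; apply: (pdC U _ _ _ _ oU (smooth_pd k (smooth_pd l sf)) Ux). Qed.

(** The index [m] is moved outermost, [i] and [j] are exchanged inside, and [m] is moved back. This
    symmetry removes the derivatives of Christoffel symbols from the curvature. *)
Lemma pd_f3_sym13 i m j k x : U x -> pd i (f3 f m j k) x = pd j (f3 f m i k) x.
Proof.
move=> Ux; rewrite (pd_f3_sym12 i m j k x Ux) (pd_f3_sym12 j m i k x Ux).
have E : \forall y \near x, f3 f i j k y = f3 f j i k y.
  by apply: (near_open oU Ux) => y Uy; apply: f3_swap12.
exact: (near_eq_derive (ev m) E).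
Qed.
End Hessian.

Definition tf {R : realType} {n} (T : 'I_n -> 'I_n -> 'I_n -> R) (u v w : 'rV[R]_n) : R :=
  \sum_i \sum_j \sum_k u 0 i * v 0 j * w 0 k * T i j k.

Lemma tf_sym_trilinear {R : realType} {n} (T : 'I_n -> 'I_n -> 'I_n -> R) :
  (forall i j k, T i j k = T j i k) -> (forall i j k, T i j k = T i k j) ->
  sym_trilinear (tf T).
Proof.
move=> s12 s23; split=> [u v w|u v w|a u u' v w]; rewrite /tf.
- rewrite exchange_big; apply: eq_bigr => j _; apply: eq_bigr => i _; apply: eq_bigr => k _.
  by rewrite s12; ring.
- apply: eq_bigr => i _; rewrite exchange_big; apply: eq_bigr => k _; apply: eq_bigr => j _.
  by rewrite s23; ring.
- rewrite mulr_sumr -big_split; apply: eq_bigr => i _ /=.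
  rewrite mulr_sumr -big_split; apply: eq_bigr => j _ /=.
  rewrite mulr_sumr -big_split; apply: eq_bigr => k _ /=.
  by rewrite !mxE; ring.
Qed.

Lemma sum_ev {R : realType} {n} (F : 'I_n -> R) i : \sum_j (ev i : 'rV[R]_n) 0 j * F j = F i.
Proof.
rewrite (bigD1 i) //= big1 => [|j /negPf ne]; last by rewrite mxE ne mul0r.
by rewrite mxE !eqxx mul1r addr0.
Qed.

Lemma tf_ev {R : realType} {n} (T : 'I_n -> 'I_n -> 'I_n -> R) i j k :
  tf T (ev i) (ev j) (ev k) = T i j k.
Proof.
rewrite /tf -[RHS](sum_ev (fun i => T i j k)); apply: eq_bigr => i' _.
rewrite -(sum_ev (fun j => T i' j k)) mulr_sumr; apply: eq_bigr => j' _.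
rewrite -(sum_ev (fun k => T i' j' k)) !mulr_sumr; apply: eq_bigr => k' _.
by rewrite !mulrA.
Qed.

Lemma clebsch_tf {R : realType} (f : 'rV[R]_3 -> R) x :
  clebsch f x = clebsch_form (tf (fun i j k => f3 f i j k x)) (ev o0) (ev o1) (ev o2).
Proof. by rewrite /clebsch_form !tf_ev. Qed.

(** Raises the free index of t(v,w,.) with the inverse of [H]. Pairings of covectors by that inverse
    become pairings of such vectors by [H]. *)
Lemma tf_dual {R : realType} {n} (H : 'M[R]_n) (T : 'I_n -> 'I_n -> 'I_n -> R) v w :
  H \in unitmx -> exists a, forall y, qf H a y = tf T v w y.
Proof.
move=> uH; exists ((\row_k \sum_i \sum_j v 0 i * w 0 j * T i j k) *m invmx H) => y.
rewrite qfE mulmxKV // mxE /tf.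
under [RHS]eq_bigr do rewrite exchange_big.
rewrite [RHS]exchange_big; apply: eq_bigr => k _; rewrite !mxE mulr_suml.
apply: eq_bigr => i _; rewrite mulr_suml; apply: eq_bigr => j _.
by rewrite mulrAC.
Qed.

Section Euler.
Context {R : realType} {U : set 'rV[R]_3} {f : 'rV[R]_3 -> R} {d : R}.
Hypotheses (oU : open U) (sf : smooth_on U f) (hom : homogeneous_on U f d).

Lemma euler_hess x (v : 'rV[R]_3) : U x ->
  qf (hess f x) x v = (d - 1) * \sum_i pd i f x * v 0 i.
Proof.
move=> Ux; rewrite /qf exchange_big mulr_sumr; apply: eq_bigr => j _.
rewrite -mulr_suml mulrA -(euler_pd U f d oU sf (euler_identity U f d oU sf hom) j x Ux).
by congr (_ * _); apply: eq_bigr => i _; rewrite mxE.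
Qed.

Lemma euler_f3 x (v w : 'rV[R]_3) : U x ->
  tf (fun i j k => f3 f i j k x) x v w = (d - 2) * qf (hess f x) v w.
Proof.
move=> Ux; rewrite /tf exchange_big /qf mulr_sumr; apply: eq_bigr => j _.
rewrite exchange_big mulr_sumr; apply: eq_bigr => k _.
have e1 := euler_pd U f d oU sf (euler_identity U f d oU sf hom).
have e2 := euler_pd U (pd k f) (d - 1) oU (smooth_pd k sf) (e1 k) j x Ux.
have -> : d - 2 = d - 1 - 1 by ring.
rewrite mxE.
transitivity (v 0 j * w 0 k * \sum_i x 0 i * f3 f i j k x).
  by rewrite mulr_sumr; apply: eq_bigr => i _; ring.
rewrite e2; ring.
Qed.

Lemma euler_norm x : U x -> qf (hess f x) x x = d * (d - 1) * f x.
Proof.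
move=> Ux; rewrite euler_hess // -mulrA mulrCA -(euler_identity U f d oU sf hom x Ux).
by congr (_ * _); apply: eq_bigr => i _; rewrite mulrC.
Qed.
End Euler.

(** * Curvature of the ambient Hessian metric *)

Lemma qfZ {R : realType} {n} c (M : 'M[R]_n) v w : qf (c *: M) v w = c * qf M v w.
Proof. by rewrite !qfE -scalemxAr -scalemxAl mxE. Qed.

(** Separates the contraction of a product of two Christoffel symbols with four vectors: the inner
    pair [b], [c] goes into [A], the outer pair [a], [e] into [B]. *)
Lemma quad_sum {R : realType} {n} (a b c e : 'I_n -> R) (A B : 'I_n -> 'I_n -> 'I_n -> R) :
  \sum_i \sum_j \sum_k \sum_m a i * b j * c k * e m * (\sum_l A l j k * B l i m) =
  \sum_l (\sum_j \sum_k b j * c k * A l j k) * (\sum_i \sum_m a i * e m * B l i m).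
Proof.
transitivity (\sum_i \sum_j \sum_k \sum_m \sum_l
    (b j * c k * A l j k) * (a i * e m * B l i m)).
  do 4 (apply: eq_bigr => ? _); rewrite mulr_sumr; apply: eq_bigr => l _; ring.
under eq_bigr do under eq_bigr do under eq_bigr do rewrite exchange_big.
under eq_bigr do under eq_bigr do rewrite exchange_big.
under eq_bigr do rewrite exchange_big.
rewrite exchange_big; apply: eq_bigr => l _ /=.
rewrite mulr_sumr; apply: eq_bigr => i _; rewrite mulr_suml; apply: eq_bigr => j _.
by rewrite mulr_suml; apply: eq_bigr => k _; rewrite mulr_sumr.
Qed.

(** Pairing a vanishing combination of x, v, w with [x] kills the coefficient of [x], which is not
    null; independence of [v] and [w] does the rest. *)
Lemma mat3_unit {R : realType} (g : 'rV[R]_3 -> 'rV[R]_3 -> R) (x v w : 'rV[R]_3) :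
  sym_bilinear g -> g x v = 0 -> g x w = 0 -> g x x != 0 ->
  row_free (col_mx v w) -> mat3 x v w \in unitmx.
Proof.
move=> hg xv xw xx fr; rewrite -row_free_unit; apply: inj_row_free => u.
have -> : u *m mat3 x v w = u 0 o0 *: x + u 0 o1 *: v + u 0 o2 *: w.
  by apply/rowP => j; rewrite !mxE sum3E !mxE.
move=> E.
have u0 : u 0 o0 = 0.
  have : g x (u 0 o0 *: x + u 0 o1 *: v + u 0 o2 *: w) = 0.
    by rewrite E (bilC hg) (bil0l hg).
  rewrite !(bilDr hg) !(bilZr hg) xv xw !mulr0 !addr0 => /eqP.
  by rewrite mulf_eq0 (negPf xx) orbF => /eqP.
have : row_mx (u 0 o1)%:M (u 0 o2)%:M = row_mx 0 0 :> 'rV_(1 + 1).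
  apply: (row_free_inj fr); rewrite /= !mul_row_col !mul_scalar_mx !mul0mx addr0.
  by rewrite -E u0 scale0r add0r.
move=> /eq_row_mx[/matrixP/(_ 0 0) u1 /matrixP/(_ 0 0) u2].
move: u1 u2; rewrite !mxE !eqxx /= !mulr1n => u1 u2.
by apply/rowP; apply: ord3P; rewrite mxE.
Qed.

Lemma d_neq0 {R : realType} (d : R) : 2 < d -> d != 0 /\ d - 1 != 0.
Proof. by move=> d2; split; apply: lt0r_neq0; lra. Qed.

Section Ambient.
Context {R : realType} {U : set 'rV[R]_3} {f : 'rV[R]_3 -> R} {d : R}.
Hypotheses (oU : open U) (sf : smooth_on U f) (d2 : 2 < d).
Hypothesis hne : forall x, U x -> hessdet f x != 0.

Let c : R := - (d * (d - 1))^-1.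

Lemma fmetric_coef_neq0 : c != 0.
Proof. by have [d0 d1] := d_neq0 d d2; rewrite oppr_eq0 invr_eq0 mulf_neq0. Qed.

Lemma fmetric_sym y : U y -> (fmetric f d y)^T = fmetric f d y.
Proof. by move=> Uy; rewrite /fmetric linearZ /= (hess_sym oU sf). Qed.

Lemma hess_unit y : U y -> hess f y \in unitmx.
Proof. by move=> Uy; rewrite unitmxE unitfE; apply: hne. Qed.

Lemma fmetric_unit y : U y -> fmetric f d y \in unitmx.
Proof.
by move=> Uy; rewrite unitmxZ ?hess_unit // unitfE fmetric_coef_neq0.
Qed.

Lemma is_derive_fmetric x k a b : U x ->
  is_derive x (ev k) (fun y => fmetric f d y a b) (c * f3 f k a b x).
Proof.
move=> Ux.
have -> : (fun y => fmetric f d y a b) = (fun y => c * hess f y a b).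
  by apply/funext => y; rewrite mxE.
have dh := smooth_derivable k (smooth_hess sf a b) Ux.
apply: is_derive_eq (is_derive_mul (is_derive_cst c x (ev k)) (derivableP dh)) _.
by rewrite mul0r add0r; congr (_ * _); exact: pd_hess.
Qed.

(** For a Hessian metric the three derivatives in the symbol are the same third derivative of [f],
    with signs +, +, -. *)
Lemma christoffel1_fmetric m j k y : U y ->
  christoffel1 (fmetric f d) m j k y = c / 2 * f3 f m j k y.
Proof.
move=> Uy; rewrite /christoffel1 /pd.
rewrite (@derive_val _ _ _ _ _ _ _ (is_derive_fmetric y j k m Uy)).
rewrite (@derive_val _ _ _ _ _ _ _ (is_derive_fmetric y k j m Uy)).
rewrite (@derive_val _ _ _ _ _ _ _ (is_derive_fmetric y m j k Uy)).
rewrite (f3_swap12 oU sf k j m y Uy) (f3_swap23 oU sf j k m y Uy) (f3_swap12 oU sf j m k y Uy).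
by field.
Qed.

Lemma is_derive_christoffel1 x i m j k : U x ->
  is_derive x (ev i) (christoffel1 (fmetric f d) m j k) (c / 2 * pd i (f3 f m j k) x).
Proof.
move=> Ux.
have E : \forall y \near x, c / 2 * f3 f m j k y = christoffel1 (fmetric f d) m j k y.
  by apply: (near_open oU Ux) => y Uy; rewrite christoffel1_fmetric.
apply: near_eq_is_derive E _.
have dh := smooth_derivable i (smooth_f3 sf m j k) Ux.
apply: is_derive_eq (is_derive_mul (is_derive_cst (c / 2) x (ev i)) (derivableP dh)) _.
by rewrite mul0r add0r.
Qed.

(* the fourth derivatives cancel by symmetry *)
Lemma Rm_fmetric x i j k m : U x ->
  Rm (fmetric f d) i j k m x =
   \sum_l Gamma (fmetric f d) l i k x * christoffel1 (fmetric f d) l j m x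
   - \sum_l Gamma (fmetric f d) l j k x * christoffel1 (fmetric f d) l i m x.
Proof.
move=> Ux; rewrite (Rm_christoffel (fmetric f d) x i j k m).
- have -> : pd i (christoffel1 (fmetric f d) m j k) x = pd j (christoffel1 (fmetric f d) m i k) x.
    have P a b e g : pd a (christoffel1 (fmetric f d) b e g) x = c / 2 * pd a (f3 f b e g) x.
      exact: (@derive_val _ _ _ _ _ _ _ (is_derive_christoffel1 x a b e g Ux)).
    by rewrite (P i m j k) (P j m i k) (pd_f3_sym13 oU sf i m j k x Ux).
  by rewrite subrr sub0r addrC.
- by apply: (near_open oU Ux) => y; apply: fmetric_sym.
- by apply: (near_open oU Ux) => y; apply: fmetric_unit.
- by move=> a b e; have [] := is_derive_fmetric x a b e Ux.
- by move=> a b e g; have [] := is_derive_christoffel1 x a b e g Ux.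
Qed.

Lemma f3_sym_trilinear x : U x -> sym_trilinear (tf (fun i j k => f3 f i j k x)).
Proof.
move=> Ux; apply: tf_sym_trilinear => i j k; [exact: (f3_swap12 oU sf)|exact: (f3_swap23 oU sf)].
Qed.

(** The Christoffel vector of a pair y, z is half the vector dual to t(y,z,.), so each quadratic
    term in the curvature is [c / 4] times a pairing of dual vectors. *)
Lemma curvature_numerator x (v w avv avw aww : 'rV[R]_3) : U x ->
  let t := tf (fun i j k => f3 f i j k x) in let H := hess f x in
  (forall y, qf H avv y = t v v y) -> (forall y, qf H avw y = t v w y) ->
  (forall y, qf H aww y = t w w y) ->
  \sum_i \sum_j \sum_k \sum_m v 0 i * w 0 j * w 0 k * v 0 m * Rm (fmetric f d) i j k m x =
  - (c / 4) * (qf H avv aww - qf H avw avw).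
Proof.
move=> Ux t H Avv Avw Aww.
have [s12 s23 _] := f3_sym_trilinear x Ux; rewrite -/t in s12 s23.
have hq := qf_sym_bilinear H (hess_sym oU sf x Ux).
pose Gv (y z : 'rV[R]_3) : 'rV[R]_3 := \row_l \sum_j \sum_k y 0 j * z 0 k * Gamma (fmetric f d) l j k x.
have lower y z s : qf (fmetric f d x) (Gv y z) s = c / 2 * t y z s.
  rewrite s23 s12 /t /tf /qf /Gv exchange_big mulr_sumr; apply: eq_bigr => m _ /=.
  rewrite -mulr_suml.
  transitivity ((\sum_j \sum_k y 0 j * z 0 k * christoffel1 (fmetric f d) m j k x) * s 0 m).
    congr (_ * _).
    transitivity (\sum_l \sum_j \sum_k y 0 j * z 0 k * (Gamma (fmetric f d) l j k x * fmetric f d x l m)).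
      apply: eq_bigr => l _; rewrite mxE mulr_suml; apply: eq_bigr => j _.
      by rewrite mulr_suml; apply: eq_bigr => k _; rewrite mulrA.
    rewrite exchange_big; apply: eq_bigr => j _; rewrite exchange_big; apply: eq_bigr => k _.
    by rewrite -mulr_sumr (Gamma_lower (fmetric f d) m j k x (fmetric_sym x Ux) (fmetric_unit x Ux)).
  rewrite mulr_suml mulr_sumr; apply: eq_bigr => j _.
  rewrite mulr_suml mulr_sumr; apply: eq_bigr => k _.
  by rewrite christoffel1_fmetric //; ring.
have contract y z a b s : (forall r, qf H s r = t a b r) -> forall s', (forall r, qf H s' r = t y z r) ->
    \sum_l (\sum_j \sum_k y 0 j * z 0 k * Gamma (fmetric f d) l j k x)
         * (\sum_i \sum_m a 0 i * b 0 m * christoffel1 (fmetric f d) l i m x)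
    = c / 4 * qf H s s'.
  move=> As s' As'.
  transitivity (c / 2 * t (Gv y z) a b).
    rewrite /t /tf /Gv mulr_sumr; apply: eq_bigr => l _; rewrite mxE.
    move: (\sum_j _) => q; rewrite !mulr_sumr; apply: eq_bigr => i _.
    rewrite !mulr_sumr; apply: eq_bigr => m _.
    by rewrite christoffel1_fmetric //; ring.
  have := lower y z s; rewrite /fmetric qfZ -/c -/H => L.
  rewrite s12 s23 -As (bilC hq) ; rewrite -As' (bilC hq s') in L.
  have -> : c / 4 * qf H s s' = 2^-1 * (c / 2 * qf H s s') by field.
  by rewrite -L; ring.
transitivity (\sum_i \sum_j \sum_k \sum_m v 0 i * w 0 j * w 0 k * v 0 m *
     (\sum_l Gamma (fmetric f d) l i k x * christoffel1 (fmetric f d) l j m x)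
   - \sum_i \sum_j \sum_k \sum_m v 0 i * w 0 j * w 0 k * v 0 m *
     (\sum_l Gamma (fmetric f d) l j k x * christoffel1 (fmetric f d) l i m x)).
  rewrite -sumrB; apply: eq_bigr => i _; rewrite -sumrB; apply: eq_bigr => j _.
  rewrite -sumrB; apply: eq_bigr => k _; rewrite -sumrB; apply: eq_bigr => m _.
  by rewrite Rm_fmetric // mulrBr.
rewrite (quad_sum (v 0) (w 0) (w 0) (v 0) (fun l j k => Gamma (fmetric f d) l j k x)
   (fun l i m => christoffel1 (fmetric f d) l i m x)).
rewrite (contract w w v v avv Avv aww Aww).
(* In the remaining term [i] and [j] have exchanged roles; summing over [j] first brings it to the
   pattern of [quad_sum]. *)
rewrite exchange_big /=.
have -> : \sum_j \sum_i \sum_k \sum_m v 0 i * w 0 j * w 0 k * v 0 m *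
     (\sum_l Gamma (fmetric f d) l i k x * christoffel1 (fmetric f d) l j m x) =
   \sum_j \sum_i \sum_k \sum_m w 0 j * v 0 i * w 0 k * v 0 m *
     (\sum_l Gamma (fmetric f d) l i k x * christoffel1 (fmetric f d) l j m x).
  apply: eq_bigr => j _; apply: eq_bigr => i _; apply: eq_bigr => k _; apply: eq_bigr => m _.
  by rewrite (mulrC (v 0 i)).
rewrite (quad_sum (w 0) (v 0) (w 0) (v 0) (fun l j k => Gamma (fmetric f d) l j k x)
   (fun l i m => christoffel1 (fmetric f d) l i m x)).
rewrite (contract v w w v avw _ avw Avw); last by move=> r; rewrite s12.
by move: (qf H avv aww) (qf H avw avw) => X Y; ring.
Qed.
End Ambient.

(** The scalar evaluation shared by both curvatures: the quotient is the ambient sectional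
    curvature, as [c ^+ 2] times the Gram determinant for [H] is the Gram determinant for the
    metric. The surface also relies on the nonvanishing of that determinant. *)
Lemma curvature_value {R : realType} {U : set 'rV[R]_3} {f : 'rV[R]_3 -> R} {d : R}
    (x v w avv avw aww : 'rV[R]_3) :
  open U -> smooth_on U f -> 2 < d -> homogeneous_on U f d ->
  (forall x, U x -> hessdet f x != 0) -> U x -> f x = 1 ->
  let c := - (d * (d - 1))^-1 in
  let t := tf (fun i j k => f3 f i j k x) in let H := hess f x in
  qf H x v = 0 -> qf H x w = 0 -> row_free (col_mx v w) ->
  (forall y, qf H avv y = t v v y) -> (forall y, qf H avw y = t v w y) ->
  (forall y, qf H aww y = t w w y) ->
  qf H v v * qf H w w - qf H v w ^+ 2 != 0 /\
  - (c / 4) * (qf H avv aww - qf H avw avw)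
    / (c ^+ 2 * (qf H v v * qf H w w - qf H v w ^+ 2)) =
  d ^+ 2 * (d - 1) ^+ 2 / (4 * (d - 2) ^+ 2) * (clebsch f x / hessdet f x ^+ 2).
Proof.
move=> oU sf d2 hom hne Ux fx c t H xv xw fr Avv Avw Aww.
have sH := hess_sym oU sf x Ux.
have hq := qf_sym_bilinear H sH.
have [d0 [d1 dd]] : d != 0 /\ (d - 1 != 0 /\ d - 2 != 0).
  by split; [|split]; apply: lt0r_neq0; move: d2; lra.
have xx : qf H x x = d * (d - 1) by rewrite (euler_norm oU sf hom) // fx mulr1.
have xx0 : qf H x x != 0 by rewrite xx mulf_neq0.
have uB := mat3_unit _ x v w hq xv xw xx0 fr.
have H0 : \det H != 0 := hne x Ux.
have B0 : \det (mat3 x v w) != 0 by rewrite -unitfE -unitmxE.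
have D0 : qf H v v * qf H w w - qf H v w ^+ 2 != 0.
  have : qf H x x * (qf H v v * qf H w w - qf H v w ^+ 2) != 0.
    by rewrite -det_gram // mulf_neq0 // expf_neq0.
  by rewrite mulf_eq0 negb_or => /andP[].
split=> //.
have K := clebsch_curvature H t x v w avv avw aww (d - 2) sH
  (f3_sym_trilinear oU sf x Ux) uB (fun y z => euler_f3 oU sf hom x y z Ux) xv xw H0 Avv Avw Aww.
rewrite clebsch_tf -/t /hessdet -/H; move: K; rewrite xx /c.
move: D0 H0; move: (qf H avv aww - qf H avw avw) (qf H v v * qf H w w - qf H v w ^+ 2) (\det H).
move: (clebsch_form t _ _ _) => S N D h D0 h0 K.
have -> : S = (d - 2) ^+ 2 * N * h ^+ 2 / (d * (d - 1) * D).
  by rewrite -K; field; rewrite d0 d1 D0.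
by field; rewrite d0 d1 D0 dd h0.
Qed.

Lemma ambient_sec_curv {R : realType} {U : set 'rV[R]_3} {f : 'rV[R]_3 -> R} {d : R}
    (p v w : 'rV[R]_3) :
  open U -> smooth_on U f -> 2 < d -> homogeneous_on U f d ->
  (forall x, U x -> hessdet f x != 0) -> U p -> f p = 1 ->
  tangent f p v -> tangent f p w -> row_free (col_mx v w) ->
  sec_curv (fmetric f d) p v w =
    d ^+ 2 * (d - 1) ^+ 2 / (4 * (d - 2) ^+ 2) * (clebsch f p * f p / (hessdet f p) ^+ 2).
Proof.
move=> oU sf d2 hom hne Up fp tv tw fr.
have tan y : tangent f p y -> qf (hess f p) p y = 0.
  by move=> ty; rewrite (euler_hess oU sf hom) // [X in _ * X]ty mulr0.
have uH := hess_unit hne p Up.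
pose T i j k := f3 f i j k p.
have [avv Avv] := tf_dual (hess f p) T v v uH.
have [avw Avw] := tf_dual (hess f p) T v w uH.
have [aww Aww] := tf_dual (hess f p) T w w uH.
rewrite fp mulr1; have [_ <-] := curvature_value p v w avv avw aww oU sf d2 hom hne Up fp
  (tan v tv) (tan w tw) fr Avv Avw Aww.
rewrite /sec_curv (curvature_numerator oU sf d2 hne p v w avv avw aww Up Avv Avw Aww).
congr (_ / _).
have b y z : bil (fmetric f d) p y z = - (d * (d - 1))^-1 * qf (hess f p) y z.
  by rewrite -qfZ.
by rewrite !b; ring.
Qed.

(** * Curvature of the level surface *)

Lemma is_derive_qf {R : realType} {V : normedModType R} {n} (M : V -> 'M[R]_n)
    (a b : V -> 'rV[R]_n) (dM : 'M[R]_n) (da db : 'rV[R]_n) (x v : V) :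
  (forall i j, is_derive x v (fun y => M y i j) (dM i j)) ->
  (forall i, is_derive x v (fun y => a y 0 i) (da 0 i)) ->
  (forall i, is_derive x v (fun y => b y 0 i) (db 0 i)) ->
  is_derive x v (fun y => qf (M y) (a y) (b y))
    (qf dM (a x) (b x) + qf (M x) da (b x) + qf (M x) (a x) db).
Proof.
move=> hM ha hb; rewrite /qf -!big_split; apply: is_derive_bigsum => i /=.
rewrite -!big_split; apply: is_derive_bigsum => j /=.
apply: is_derive_eq (is_derive_mul (is_derive_mul (ha i) (hM i j)) (hb j)) _.
ring.
Qed.

Lemma is_derive_tf {R : realType} {V : normedModType R} {n}
    (T : V -> 'I_n -> 'I_n -> 'I_n -> R) (a b c : V -> 'rV[R]_n)
    (dT : 'I_n -> 'I_n -> 'I_n -> R) (da db dc : 'rV[R]_n) (x v : V) :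
  (forall i j k, is_derive x v (fun y => T y i j k) (dT i j k)) ->
  (forall i, is_derive x v (fun y => a y 0 i) (da 0 i)) ->
  (forall i, is_derive x v (fun y => b y 0 i) (db 0 i)) ->
  (forall i, is_derive x v (fun y => c y 0 i) (dc 0 i)) ->
  is_derive x v (fun y => tf (T y) (a y) (b y) (c y))
    (tf dT (a x) (b x) (c x) + tf (T x) da (b x) (c x)
     + tf (T x) (a x) db (c x) + tf (T x) (a x) (b x) dc).
Proof.
move=> hT ha hb hc; rewrite /tf -!big_split; apply: is_derive_bigsum => i /=.
rewrite -!big_split; apply: is_derive_bigsum => j /=.
rewrite -!big_split; apply: is_derive_bigsum => k /=.
apply: is_derive_eq
  (is_derive_mul (is_derive_mul (is_derive_mul (ha i) (hb j)) (hc k)) (hT i j k)) _.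
ring.
Qed.

(** The Koszul combination for an induced metric, with [pj] and [pjk] standing for first and second
    derivatives of the parametrization. The result is the inner product of [pm] with the ambient
    covariant derivative of [pk] along [pj]. *)
Lemma christoffel_symmetrization {R : realType} {V : lmodType R} (t : V -> V -> V -> R)
    (g : V -> V -> R) (c : R) (pj pk pm pjk pkj pkm pmk pjm pmj : V) :
  sym_trilinear t -> sym_bilinear g -> pkj = pjk -> pmj = pjm -> pmk = pkm ->
  2^-1 * (c * (t pj pk pm + g pjk pm + g pk pjm) + c * (t pk pj pm + g pkj pm + g pj pkm)
    - c * (t pm pj pk + g pmj pk + g pj pmk)) = c * (g pjk pm + 2^-1 * t pm pj pk).
Proof.
move=> [s12 s23 _] hg -> -> ->.
rewrite (bilC hg pjm pk) (s12 pk pj pm) (s12 pm pj pk) (s23 pj pm pk).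
by field.
Qed.

(* The vectors [A + a/2] are the ambient covariant derivatives of the tangent fields; [C]
   gives their inner products with the tangent vectors, and [tang] the inner product of two
   tangential parts. *)
Lemma gauss_equation {R : realType} (t : 'rV[R]_3 -> 'rV[R]_3 -> 'rV[R]_3 -> R)
    (g : 'rV[R]_3 -> 'rV[R]_3 -> R) (c s q q' : R)
    (x v w A00 A01 A10 A11 a00 a01 a11 p3 p3' : 'rV[R]_3) :
  sym_trilinear t -> sym_bilinear g -> mat3 x v w \in unitmx ->
  g x v = 0 -> g x w = 0 -> g x x != 0 -> g v v * g w w - g v w ^+ 2 != 0 -> c != 0 ->
  (forall y, g a00 y = t v v y) -> (forall y, g a01 y = t v w y) ->
  (forall y, g a11 y = t w w y) ->
  g x A00 + 2^-1 * t x v v = s * g v v -> g x A01 + 2^-1 * t x v w = s * g v w ->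
  g x A11 + 2^-1 * t x w w = s * g w w -> A10 = A01 -> p3' = p3 -> q' = q ->
  let C A y z m := c * (g A m + 2^-1 * t m y z) in
  let tang b0 b1 e0 e1 :=
    (c * g w w * (b0 * e0) - c * g v w * (b0 * e1 + b1 * e0) + c * g v v * (b1 * e1))
    / (c * g v v * (c * g w w) - (c * g v w) ^+ 2) in
  c * (t v A11 v + g p3 v + g A11 A00
       + 2^-1 * (q + t A00 w w + t v A01 w + t v w A01))
  - c * (t w A01 v + g p3' v + g A01 A10
       + 2^-1 * (q' + t A10 v w + t v A10 w + t v v A11))
  - tang (C A11 w w v) (C A11 w w w) (C A00 v v v) (C A00 v v w)
  + tang (C A01 v w v) (C A01 v w w) (C A10 w v v) (C A10 w v w) =
  c * (- (g a00 a11 - g a01 a01) / 4 + s ^+ 2 * (g v v * g w w - g v w ^+ 2) / g x x).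
Proof.
(* The three equations rewritten here identify mixed second and third derivatives of the
   parametrization and the terms [q], [q'] with fourth derivatives of [f]; the latter two kinds then
   cancel in the difference. *)
move=> ht hg uB xv xw xx D0 c0 h00 h01 h11 x00 x01 x11 -> -> -> C tang.
have [s12 s23 _] := ht.
pose B A a : 'rV[R]_3 := A + 2^-1 *: a.
have E1 := orthogonal_expansion g x v w (B A11 a11) (B A00 a00) hg uB xv xw xx D0.
have E2 := orthogonal_expansion g x v w (B A01 a01) (B A01 a01) hg uB xv xw xx D0.
have tangE b0 b1 e0 e1 : tang (c * b0) (c * b1) (c * e0) (c * e1) =
   c * ((g w w * (b0 * e0) - g v w * (b0 * e1 + b1 * e0) + g v v * (b1 * e1))
    / (g v v * g w w - g v w ^+ 2)).
  rewrite /tang.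
  have -> : c * g v v * (c * g w w) - (c * g v w) ^+ 2
      = c ^+ 2 * (g v v * g w w - g v w ^+ 2) by ring.
  by move: (g v v * g w w - _) D0 => D D0; field; rewrite c0 D0.
have Bx A a y z : (forall y', g a y' = t y z y') -> g (B A a) x = g x A + 2^-1 * t x y z.
  by move=> h; rewrite /B (bilDl hg) (bilZl hg) h (bilC hg A) (s12 x y z) (s23 y x z).
have Bg A a y z m : (forall y', g a y' = t y z y') -> g (B A a) m = g A m + 2^-1 * t m y z.
  by move=> h; rewrite /B (bilDl hg) (bilZl hg) h (s12 m y z) (s23 y m z).
have L1 : g (B A11 a11) (B A00 a00) =
    g A11 A00 + 2^-1 * t v v A11 + 2^-1 * t w w A00 + 4^-1 * g a00 a11.
  rewrite /B !(bilDl hg) !(bilZl hg) !(bilDr hg) !(bilZr hg) h11.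
  rewrite (bilC hg A11 a00) h00 (bilC hg a11 a00); by field.
have L2 : g (B A01 a01) (B A01 a01) =
    g A01 A01 + t v w A01 + 4^-1 * g a01 a01.
  rewrite /B !(bilDl hg) !(bilZl hg) !(bilDr hg) !(bilZr hg) h01.
  rewrite (bilC hg A01 a01) h01; by field.
rewrite L1 in E1; rewrite L2 in E2.
rewrite (Bx _ _ _ _ h11) (Bx _ _ _ _ h00) x11 x00 in E1.
rewrite (Bx _ _ _ _ h01) x01 in E2.
rewrite !(Bg _ _ _ _ _ h11) !(Bg _ _ _ _ _ h00) in E1.
rewrite !(Bg _ _ _ _ _ h01) in E2.
have sw m : t m w v = t m v w by rewrite s23.
rewrite /C (sw v) (sw w) !tangE.
have -> : t v A11 v = t v v A11 by rewrite s23.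
have -> : t w A01 v = t v w A01 by rewrite s12 s23 s12 s23 s12.
have -> : t A00 w w = t w w A00 by rewrite s12 s23.
have -> : t v A01 w = t v w A01 by rewrite s23.
have -> : t A01 v w = t v w A01 by rewrite s12 s23.
move: E1 E2; move: (_ / (g v v * g w w - g v w ^+ 2)) (_ / (g v v * g w w - g v w ^+ 2)).
move: D0 xx (g p3 v) (g A11 A00) (g A01 A01) (t v v A11) (t w w A00) (t v w A01) (g a00 a11) (g a01 a01).
move: (g x x) (g v v) (g v w) (g w w) => X vv vw ww D0 X0 P G1 G2 u1 u2 u3 N1 N2 F2 F1 E1 E2.
(* The tangential parts are full inner products minus normal parts; the normal parts supply the
   terms with [s]. *)
have -> : F1 = G1 + 2^-1 * u1 + 2^-1 * u2 + 4^-1 * N1 - s * ww * (s * vv) / X by rewrite E1; ring.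
have -> : F2 = G2 + u3 + 4^-1 * N2 - s * vw * (s * vw) / X by rewrite E2; ring.
by field.
Qed.

Lemma sum2E {R : realType} (F : 'I_2 -> R) : \sum_i F i = F ord0 + F ord_max.
Proof. by rewrite !big_ord_recl big_ord0 addr0; congr (_ + F _); apply: val_inj. Qed.

(** Raises an index with the inverse of a symmetric 2 by 2 Gram matrix, in the shape of [tang] in
    [gauss_equation]. The entries [m] come with equations, so that the metric coefficients can be
    supplied by [exact]. *)
Lemma cramer2 {R : realType} (m00 m01 m10 m11 h00 h01 h11 G0 G1 C0 C1 b0 b1 : R) :
  m00 = h00 -> m01 = h01 -> m10 = h01 -> m11 = h11 ->
  h00 * h11 - h01 ^+ 2 != 0 -> G0 * m00 + G1 * m10 = C0 -> G0 * m01 + G1 * m11 = C1 ->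
  G0 * b0 + G1 * b1 =
  (h11 * (C0 * b0) - h01 * (C0 * b1 + C1 * b0) + h00 * (C1 * b1)) / (h00 * h11 - h01 ^+ 2).
Proof. by move=> -> -> -> -> D <- <-; field. Qed.

Lemma unitmx2 {R : realType} (M : 'M[R]_2) (h00 h01 h11 : R) :
  M ord0 ord0 = h00 -> M ord0 ord_max = h01 -> M ord_max ord0 = h01 -> M ord_max ord_max = h11 ->
  h00 * h11 - h01 ^+ 2 != 0 -> M \in unitmx.
Proof.
move=> e00 e01 e10 e11 h; rewrite unitmxE unitfE det2E.
have -> : (1 : 'I_2) = ord_max by apply: val_inj.
by rewrite e00 e01 e10 e11 -expr2.
Qed.

Lemma gram_scale {R : realType} (k vv vw ww : R) :
  k != 0 -> vv * ww - vw ^+ 2 != 0 -> k * vv * (k * ww) - (k * vw) ^+ 2 != 0.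
Proof.
move=> k0 D0; have -> : k * vv * (k * ww) - (k * vw) ^+ 2 = k ^+ 2 * (vv * ww - vw ^+ 2) by ring.
by rewrite mulf_neq0 // expf_neq0.
Qed.

(* [k * X = -1] is the squared length of the normal. *)
Lemma gauss_value {R : realType} (d num b00 b01 b11 vv vw ww N X K : R) :
  let k := - (d * (d - 1))^-1 in
  d != 0 -> d - 1 != 0 -> vv * ww - vw ^+ 2 != 0 -> X = d * (d - 1) ->
  num = k * (- N / 4 + (- (d / 2)) ^+ 2 * (vv * ww - vw ^+ 2) / X) ->
  b00 = k * vv -> b01 = k * vw -> b11 = k * ww ->
  - (k / 4) * N / (k ^+ 2 * (vv * ww - vw ^+ 2)) = K ->
  num / (b00 * b11 - b01 ^+ 2) = - (d ^+ 2 / 4) + K.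
Proof.
move=> k d0 d1 D0 -> -> -> -> -> <-.
have -> : k * vv * (k * ww) - (k * vw) ^+ 2 = k ^+ 2 * (vv * ww - vw ^+ 2) by ring.
by rewrite /k; move: (vv * ww - _) D0 => D D0; field; rewrite d0 d1 D0.
Qed.

Lemma qf_ev {R : realType} {n} (M : 'M[R]_n) i j : qf M (ev i) (ev j) = M i j.
Proof.
rewrite /qf -[RHS](sum_ev (fun i => M i j)); apply: eq_bigr => i' _.
rewrite -(sum_ev (fun j => M i' j)) mulr_sumr; apply: eq_bigr => j' _.
by rewrite mulrAC mulrA.
Qed.

Lemma sum4_ev {R : realType} {n} (F : 'I_n -> 'I_n -> 'I_n -> 'I_n -> R) a b c e :
  \sum_i \sum_j \sum_k \sum_m (ev a : 'rV[R]_n) 0 i * (ev b : 'rV[R]_n) 0 j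
    * (ev c : 'rV[R]_n) 0 k * (ev e : 'rV[R]_n) 0 m * F i j k m = F a b c e.
Proof.
rewrite -[RHS](sum_ev (fun i => F i b c e)); apply: eq_bigr => i _.
rewrite -(sum_ev (fun j => F i j c e)) mulr_sumr; apply: eq_bigr => j _.
rewrite -(sum_ev (fun k => F i j k e)) !mulr_sumr; apply: eq_bigr => k _.
rewrite -(sum_ev (fun m => F i j k m)) !mulr_sumr; apply: eq_bigr => m _.
by rewrite !mulrA.
Qed.

(** Transfers the symmetry of fourth derivatives to their contraction with tangent vectors, the case
    needed when the third derivatives are differentiated along the surface. *)
Lemma tf_contract_swap {R : realType} {n} (F : 'I_n -> 'I_n -> 'I_n -> 'I_n -> R)
    (p a b c : 'rV[R]_n) :
  (forall l i j k, F l i j k = F j i l k) ->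
  tf (fun i j k => \sum_l p 0 l * F l i j k) a b c =
  tf (fun i j k => \sum_l b 0 l * F l i j k) a p c.
Proof.
move=> sF; apply: eq_bigr => i _.
transitivity (\sum_j \sum_l \sum_k a 0 i * b 0 j * c 0 k * (p 0 l * F l i j k)).
  apply: eq_bigr => j _; rewrite exchange_big; apply: eq_bigr => k _.
  by rewrite mulr_sumr.
rewrite exchange_big; apply: eq_bigr => l _ /=.
rewrite exchange_big; apply: eq_bigr => k _ /=.
by rewrite mulr_sumr; apply: eq_bigr => j _; rewrite sF; ring.
Qed.

(** * Induced metric and curvature of a parametrized level surface *)

Section Surface.
Context {R : realType} {U : set 'rV[R]_3} {f : 'rV[R]_3 -> R} {d : R}.
Hypotheses (oU : open U) (sf : smooth_on U f) (d2 : 2 < d).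
Hypotheses (hom : homogeneous_on U f d) (hne : forall x, U x -> hessdet f x != 0).
Context {W : set 'rV[R]_2} {phi : 'rV[R]_2 -> 'rV[R]_3}.
Hypotheses (oW : open W) (sphi : forall i : 'I_3, smooth_on W (fun y => phi y 0 i)).
Hypothesis M1 : forall y, W y -> U (phi y) /\ f (phi y) = 1.
Hypothesis imm : forall y, W y ->
  row_free (col_mx (dphi phi ord0 y) (dphi phi ord_max y)).

Let c : R := - (d * (d - 1))^-1.
Let H y := hess f (phi y).
Let T y i j k := f3 f i j k (phi y).
(** [P] is the derivative of the vector-valued map, as in [pullback], whereas [P2] and [P3] are
    taken coordinate by coordinate, as in the smoothness hypothesis. [P_coord] reconciles the two on
    [W]. *)
Let P (a : 'I_2) y := dphi phi a y.
Let P2 (a b : 'I_2) y : 'rV[R]_3 := \row_i pd a (pd b (fun z => phi z 0 i)) y.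
Let P3 (e a b : 'I_2) y : 'rV[R]_3 := \row_i pd e (pd a (pd b (fun z => phi z 0 i))) y.
Let Q e y i j k := \sum_l P e y 0 l * pd l (f3 f i j k) (phi y).

Let Uphi y : W y -> U (phi y). Proof. by move=> /M1[]. Qed.

Let dphi_derivable a y : W y -> derivable phi y (ev a).
Proof.
by move=> Wy; apply/derivable_mxP => i j; rewrite (ord1 i); apply: (smooth_derivable a (sphi j)).
Qed.

Let P_coord a y i : W y -> P a y 0 i = pd a (fun z => phi z 0 i) y.
Proof. by move=> Wy; exact: derive_row (dphi_derivable a y Wy). Qed.

Let is_derive_P e a y i : W y -> is_derive y (ev e) (fun z => P a z 0 i) (P2 e a y 0 i).
Proof.
move=> Wy.
have E : \forall z \near y, pd a (fun z => phi z 0 i) z = P a z 0 i.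
  by apply: (near_open oW Wy) => z Wz; rewrite P_coord.
apply: near_eq_is_derive E _; rewrite mxE.
exact: derivableP (smooth_derivable e (smooth_pd a (sphi i)) Wy).
Qed.

Let is_derive_P2 e a b y i : W y -> is_derive y (ev e) (fun z => P2 a b z 0 i) (P3 e a b y 0 i).
Proof.
move=> Wy.
have -> : (fun z => P2 a b z 0 i) = pd a (pd b (fun z => phi z 0 i)).
  by apply/funext => z; rewrite mxE.
rewrite mxE.
exact: derivableP (smooth_derivable e (smooth_pd a (smooth_pd b (sphi i))) Wy).
Qed.

Let is_derive_H e y i j : W y ->
  is_derive y (ev e) (fun z => H z i j) ((\matrix_(i, j) \sum_l P e y 0 l * T y l i j) i j).
Proof.
move=> Wy.
apply: is_derive_eq (is_derive_chain phi y (ev e) oU (smooth_hess sf i j) (Uphi y Wy) (dphi_derivable e y Wy)) _.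
by rewrite mxE; apply: eq_bigr => l _; rewrite pd_hess.
Qed.

Let is_derive_T e y i j k : W y -> is_derive y (ev e) (fun z => T z i j k) (Q e y i j k).
Proof.
move=> Wy.
exact: (is_derive_chain phi y (ev e) oU (smooth_f3 sf i j k) (Uphi y Wy) (dphi_derivable e y Wy)).
Qed.

Let qf_dH (S : 'I_3 -> 'I_3 -> 'I_3 -> R) (p a b : 'rV[R]_3) :
  qf (\matrix_(i, j) \sum_l p 0 l * S l i j) a b = tf S p a b.
Proof.
rewrite /tf exchange_big; apply: eq_bigr => i _ /=.
rewrite exchange_big; apply: eq_bigr => j _ /=.
by rewrite mxE mulr_sumr mulr_suml; apply: eq_bigr => l _; ring.
Qed.

Let P2E a b y i : P2 a b y 0 i = pd a (pd b (fun z => phi z 0 i)) y.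
Proof. by rewrite mxE. Qed.

Let P3E e a b y i : P3 e a b y 0 i = pd e (pd a (pd b (fun z => phi z 0 i))) y.
Proof. by rewrite mxE. Qed.

Let P2C a b y : W y -> P2 a b y = P2 b a y.
Proof.
move=> Wy; apply/rowP => i.
exact: etrans (P2E a b y i) (etrans (pdC W _ y a b oW (sphi i) Wy) (esym (P2E b a y i))).
Qed.

Let P3C e a b y : W y -> P3 e a b y = P3 a e b y.
Proof.
move=> Wy; apply/rowP => i.
exact: etrans (P3E e a b y i) (etrans (pdC W _ y e a oW (smooth_pd b (sphi i)) Wy)
  (esym (P3E a e b y i))).
Qed.

Let pullbackE a b y : pullback (fmetric f d) phi y a b = c * qf (H y) (P a y) (P b y).
Proof. by rewrite mxE -qfZ. Qed.

Let is_derive_pullback e a b y : W y ->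
  is_derive y (ev e) (fun z => pullback (fmetric f d) phi z a b)
   (c * (tf (T y) (P e y) (P a y) (P b y) + qf (H y) (P2 e a y) (P b y)
         + qf (H y) (P a y) (P2 e b y))).
Proof.
move=> Wy.
have -> : (fun z => pullback (fmetric f d) phi z a b) = (fun z => c * qf (H z) (P a z) (P b z)).
  by apply/funext => z; exact: pullbackE.
have h := is_derive_qf H (P a) (P b) _ _ _ y (ev e) (fun i j => is_derive_H e y i j Wy)
  (fun i => is_derive_P e a y i Wy) (fun i => is_derive_P e b y i Wy).
apply: is_derive_eq (is_derive_mul (is_derive_cst c y (ev e)) h) _.
by rewrite mul0r add0r qf_dH.
Qed.

Let tri y : W y -> sym_trilinear (tf (T y)).
Proof. by move=> Wy; exact: f3_sym_trilinear oU sf _ (Uphi y Wy). Qed.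

Let Hsym y : W y -> (H y)^T = H y.
Proof. by move=> Wy; exact: hess_sym oU sf _ (Uphi y Wy). Qed.

Let bili y : W y -> sym_bilinear (qf (H y)).
Proof. by move=> /Hsym; exact: qf_sym_bilinear. Qed.

Let christoffel1_pullback m j k y : W y ->
  christoffel1 (pullback (fmetric f d) phi) m j k y =
  c * (qf (H y) (P2 j k y) (P m y) + 2^-1 * tf (T y) (P m y) (P j y) (P k y)).
Proof.
move=> Wy; rewrite /christoffel1 /pd.
rewrite (@derive_val _ _ _ _ _ _ _ (is_derive_pullback j k m y Wy)).
rewrite (@derive_val _ _ _ _ _ _ _ (is_derive_pullback k j m y Wy)).
rewrite (@derive_val _ _ _ _ _ _ _ (is_derive_pullback m j k y Wy)).
exact: (christoffel_symmetrization (tf (T y)) (qf (H y)) c (P j y) (P k y) (P m y) (P2 j k y)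
  (P2 k j y) (P2 k m y) (P2 m k y) (P2 j m y) (P2 m j y) (tri y Wy) (bili y Wy)
  (P2C k j y Wy) (P2C m j y Wy) (P2C m k y Wy)).
Qed.

Let is_derive_christoffel1_pullback e m j k y : W y ->
  is_derive y (ev e) (christoffel1 (pullback (fmetric f d) phi) m j k)
   (c * (tf (T y) (P e y) (P2 j k y) (P m y) + qf (H y) (P3 e j k y) (P m y)
         + qf (H y) (P2 j k y) (P2 e m y)
         + 2^-1 * (tf (Q e y) (P m y) (P j y) (P k y) + tf (T y) (P2 e m y) (P j y) (P k y)
     + tf (T y) (P m y) (P2 e j y) (P k y) + tf (T y) (P m y) (P j y) (P2 e k y)))).
Proof.
move=> Wy.
have E : \forall z \near y, c * (qf (H z) (P2 j k z) (P m z) + 2^-1 * tf (T z) (P m z) (P j z) (P k z))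
    = christoffel1 (pullback (fmetric f d) phi) m j k z.
  by apply: (near_open oW Wy) => z Wz; rewrite christoffel1_pullback.
apply: near_eq_is_derive E _.
have h1 := is_derive_qf H (P2 j k) (P m) _ _ _ y (ev e) (fun i j => is_derive_H e y i j Wy)
  (fun i => is_derive_P2 e j k y i Wy) (fun i => is_derive_P e m y i Wy).
have h2 := is_derive_tf T (P m) (P j) (P k) _ _ _ _ y (ev e)
  (fun i j k => is_derive_T e y i j k Wy) (fun i => is_derive_P e m y i Wy)
  (fun i => is_derive_P e j y i Wy) (fun i => is_derive_P e k y i Wy).
have h3 := is_derive_mul (is_derive_cst (2^-1 : R) y (ev e)) h2.
have h4 := is_deriveD h1 h3.
apply: is_derive_eq (is_derive_mul (is_derive_cst c y (ev e)) h4) _.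
by rewrite !mul0r !add0r qf_dH.
Qed.

Let gradient_P a y : W y -> \sum_i P a y 0 i * pd i f (phi y) = 0.
Proof.
move=> Wy.
have D := is_derive_chain phi y (ev a) oU sf (Uphi y Wy) (dphi_derivable a y Wy).
(* The parametrization stays on the level set, so [f] composed with [phi] has derivative zero. *)
have E : \forall z \near y, 1 = f (phi z).
  by apply: (near_open oW Wy) => z /M1[].
have D' : is_derive y (ev a) (fun z => f (phi z)) 0.
  apply: near_eq_is_derive E _; exact: is_derive_cst.
exact: etrans (esym (@derive_val _ _ _ _ _ _ _ D)) (@derive_val _ _ _ _ _ _ _ D').
Qed.

Let orth a y : W y -> qf (H y) (phi y) (P a y) = 0.
Proof.
move=> Wy; rewrite (euler_hess oU sf hom _ _ (Uphi y Wy)).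
have := gradient_P a y Wy; under eq_bigr do rewrite mulrC.
by move=> ->; rewrite mulr0.
Qed.

(* second fundamental form: the gradient of f has derivative hess f, and it
   annihilates the tangent vectors *)
Let orth2 a b y : W y ->
  qf (H y) (phi y) (P2 a b y) = - (d - 1) * qf (H y) (P a y) (P b y).
Proof.
move=> Wy; rewrite (euler_hess oU sf hom _ _ (Uphi y Wy)) mulNr -mulrN; congr (_ * _).
have D : is_derive y (ev a) (fun z => \sum_i P b z 0 i * pd i f (phi z))
    (\sum_i (P2 a b y 0 i * pd i f (phi y)
       + P b y 0 i * \sum_l P a y 0 l * pd l (pd i f) (phi y))).
  apply: is_derive_bigsum => i; apply: is_derive_mul; first exact: is_derive_P.
  exact: (is_derive_chain phi y (ev a) oU (smooth_pd i sf) (Uphi y Wy) (dphi_derivable a y Wy)).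
have E : \forall z \near y, 0 = \sum_i P b z 0 i * pd i f (phi z).
  by apply: (near_open oW Wy) => z Wz; rewrite gradient_P.
have D' : is_derive y (ev a) (fun z => \sum_i P b z 0 i * pd i f (phi z)) 0.
  apply: near_eq_is_derive E _; exact: is_derive_cst.
have : \sum_i (P2 a b y 0 i * pd i f (phi y)
       + P b y 0 i * \sum_l P a y 0 l * pd l (pd i f) (phi y)) = 0.
  exact: etrans (esym (@derive_val _ _ _ _ _ _ _ D)) (@derive_val _ _ _ _ _ _ _ D').
rewrite big_split /= => /eqP; rewrite addr_eq0 => /eqP G.
transitivity (\sum_i P2 a b y 0 i * pd i f (phi y)).
  by apply: eq_bigr => i _; rewrite mulrC.
rewrite G /qf exchange_big; congr (- _); apply: eq_bigr => i _ /=.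
rewrite mulr_sumr; apply: eq_bigr => l _; rewrite mxE; ring.
Qed.
Let c_neq0 : c != 0. Proof. exact: fmetric_coef_neq0 d2. Qed.

Let pullbackC a b y : W y ->
  pullback (fmetric f d) phi y a b = c * qf (H y) (P b y) (P a y).
Proof.
move=> Wy; have e := congr1 ( *%R c) (bilC (bili y Wy) (P a y) (P b y)).
exact (etrans (pullbackE a b y) e).
Qed.

Let pullback_sym y : W y ->
  (pullback (fmetric f d) phi y)^T = pullback (fmetric f d) phi y.
Proof.
move=> Wy; apply/matrixP => a b; rewrite mxE.
exact (etrans (pullbackE b a y) (esym (pullbackC a b y Wy))).
Qed.

(** The position vector is orthogonal to the tangent plane and not null, and the ambient metric is
    nondegenerate, so the induced metric is nondegenerate too. The dual vectors only serve to invoke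
    [curvature_value]. *)
Let gram_neq0 y : W y -> qf (H y) (P ord0 y) (P ord0 y) * qf (H y) (P ord_max y) (P ord_max y)
   - qf (H y) (P ord0 y) (P ord_max y) ^+ 2 != 0.
Proof.
move=> Wy; have [Uy fy] := M1 y Wy; have uH := hess_unit hne _ Uy.
have [a00 h00] := tf_dual (H y) (T y) (P ord0 y) (P ord0 y) uH.
have [a01 h01] := tf_dual (H y) (T y) (P ord0 y) (P ord_max y) uH.
have [a11 h11] := tf_dual (H y) (T y) (P ord_max y) (P ord_max y) uH.
by have [] := curvature_value (phi y) (P ord0 y) (P ord_max y) a00 a01 a11 oU sf d2 hom hne Uy fy
  (orth ord0 y Wy) (orth ord_max y Wy) (imm y Wy) h00 h01 h11.
Qed.

Let pullback_unit y : W y -> pullback (fmetric f d) phi y \in unitmx.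
Proof.
move=> Wy; exact (unitmx2 _ _ _ _ (pullbackE ord0 ord0 y) (pullbackE ord0 ord_max y)
  (pullbackC ord_max ord0 y Wy) (pullbackE ord_max ord_max y)
  (gram_scale c _ _ _ c_neq0 (gram_neq0 y Wy))).
Qed.

Lemma surface_sec_curv u : W u ->
  sec_curv (pullback (fmetric f d) phi) u (ev ord0) (ev ord_max) =
    - (d ^+ 2 / 4) + d ^+ 2 * (d - 1) ^+ 2 / (4 * (d - 2) ^+ 2)
       * (clebsch f (phi u) * f (phi u) ^+ 2 / hessdet f (phi u) ^+ 2).
Proof.
move=> Wu; have [Uu fu] := M1 u Wu; have uH := hess_unit hne _ Uu.
have [a00 h00] := tf_dual (H u) (T u) (P ord0 u) (P ord0 u) uH.
have [a01 h01] := tf_dual (H u) (T u) (P ord0 u) (P ord_max u) uH.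
have [a11 h11] := tf_dual (H u) (T u) (P ord_max u) (P ord_max u) uH.
have [D0 K] := curvature_value (phi u) (P ord0 u) (P ord_max u) a00 a01 a11 oU sf d2 hom hne Uu fu
  (orth ord0 u Wu) (orth ord_max u Wu) (imm u Wu) h00 h01 h11.
have [d0 d1] := d_neq0 _ d2.
have xx : qf (H u) (phi u) (phi u) = d * (d - 1).
  by rewrite (euler_norm oU sf hom _ Uu) fu mulr1.
have xx0 : qf (H u) (phi u) (phi u) != 0 by rewrite xx mulf_neq0.
have uB := mat3_unit _ (phi u) (P ord0 u) (P ord_max u) (bili u Wu) (orth ord0 u Wu)
  (orth ord_max u Wu) xx0 (imm u Wu).
(* Normal component of the ambient covariant derivative: [orth2] gives -(d-1) and Euler's relation
   for third derivatives gives (d-2)/2, with sum -d/2. *)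
have normal a b : qf (H u) (phi u) (P2 a b u) + 2^-1 * tf (T u) (phi u) (P a u) (P b u)
    = - (d / 2) * qf (H u) (P a u) (P b u).
  rewrite (orth2 a b u Wu) (euler_f3 oU sf hom (phi u) (P a u) (P b u) Uu) -/(H u).
  by move: (qf _ _ _) => q; field.
have pdc e m j k := @derive_val _ _ _ _ _ _ _ (is_derive_christoffel1_pullback e m j k u Wu).
pose h a b := c * qf (H u) (P a u) (P b u).
have h0 : h ord0 ord0 * h ord_max ord_max - h ord0 ord_max ^+ 2 != 0.
  exact (gram_scale c _ _ _ c_neq0 D0).
pose C m j k := c * (qf (H u) (P2 j k u) (P m u) + 2^-1 * tf (T u) (P m u) (P j u) (P k u)).
(* The quadratic curvature terms pair tangential parts of covariant derivatives; [C] collects their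
   inner products with the tangent vectors and [h] is the induced metric. *)
have GC i j k m :
    \sum_l Gamma (pullback (fmetric f d) phi) l j k u * christoffel1 (pullback (fmetric f d) phi) l i m u
    = (h ord_max ord_max * (C ord0 j k * C ord0 i m)
       - h ord0 ord_max * (C ord0 j k * C ord_max i m + C ord_max j k * C ord0 i m)
       + h ord0 ord0 * (C ord_max j k * C ord_max i m))
      / (h ord0 ord0 * h ord_max ord_max - h ord0 ord_max ^+ 2).
  rewrite sum2E (christoffel1_pullback ord0 i m u Wu) (christoffel1_pullback ord_max i m u Wu).
  have low r := Gamma_lower (pullback (fmetric f d) phi) r j k u (pullback_sym u Wu) (pullback_unit u Wu).
  have low0 := low ord0; have low1 := low ord_max.
  rewrite sum2E (christoffel1_pullback ord0 j k u Wu) in low0.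
  rewrite sum2E (christoffel1_pullback ord_max j k u Wu) in low1.
  exact (cramer2 _ _ _ _ _ _ _ _ _ _ _ _ _ (pullbackE ord0 ord0 u) (pullbackE ord0 ord_max u)
    (pullbackC ord_max ord0 u Wu) (pullbackE ord_max ord_max u) h0 low0 low1).
have numer : Rm (pullback (fmetric f d) phi) ord0 ord_max ord_max ord0 u =
    c * (- (qf (H u) a00 a11 - qf (H u) a01 a01) / 4
      + (- (d / 2)) ^+ 2 * (qf (H u) (P ord0 u) (P ord0 u) * qf (H u) (P ord_max u) (P ord_max u)
   - qf (H u) (P ord0 u) (P ord_max u) ^+ 2) / qf (H u) (phi u) (phi u)).
  rewrite (Rm_christoffel (pullback (fmetric f d) phi) u ord0 ord_max ord_max ord0).
  - rewrite (GC ord0 ord_max ord_max ord0) (GC ord_max ord0 ord_max ord0).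
    rewrite [X in X - _ - _ + _](pdc ord0 ord0 ord_max ord_max).
    rewrite [X in _ - X - _ + _](pdc ord_max ord0 ord0 ord_max).
    (* The last argument is the equality of the two fourth-derivative terms, by symmetry of fourth
       derivatives. *)
    exact (gauss_equation (tf (T u)) (qf (H u)) c (- (d / 2)) _ _ (phi u) (P ord0 u) (P ord_max u)
      (P2 ord0 ord0 u) (P2 ord0 ord_max u) (P2 ord_max ord0 u) (P2 ord_max ord_max u) a00 a01 a11
      (P3 ord0 ord_max ord_max u) (P3 ord_max ord0 ord_max u) (tri u Wu) (bili u Wu) uB
      (orth ord0 u Wu) (orth ord_max u Wu) xx0 D0 c_neq0 h00 h01 h11 (normal ord0 ord0)
      (normal ord0 ord_max) (normal ord_max ord_max) (P2C _ _ u Wu) (P3C _ _ _ u Wu)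
      (esym (tf_contract_swap _ _ _ _ _ (fun l i j k => pd_f3_sym13 oU sf l i j k (phi u) Uu)))).
  - by apply: (near_open oW Wu) => y; apply: pullback_sym.
  - by apply: (near_open oW Wu) => y; apply: pullback_unit.
  - by move=> a b e; have [] := is_derive_pullback a b e u Wu.
  - by move=> a b e g; have [] := is_derive_christoffel1_pullback a b e g u Wu.
have bilE a b : bil (pullback (fmetric f d) phi) u (ev a) (ev b) = h a b.
  exact (etrans (qf_ev _ a b) (pullbackE a b u)).
rewrite /sec_curv sum4_ev fu expr1n mulr1.
exact (gauss_value d _ _ _ _ _ _ _ _ _ _ d0 d1 D0 xx numer (bilE ord0 ord0) (bilE ord0 ord_max)
  (bilE ord_max ord_max) K).
Qed.
End Surface.

Theorem theorem3p1 (R : realType) (U : set 'rV[R]_3) (f : 'rV[R]_3 -> R) (d : R) :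
  open U -> smooth_on U f -> 2 < d -> homogeneous_on U f d ->
  (forall x, U x -> hessdet f x != 0) ->
  (* sectional curvature of U on the tangent plane of M at p *)
  (forall p v w : 'rV[R]_3, U p -> f p = 1 ->
     tangent f p v -> tangent f p w -> row_free (col_mx v w) ->
     sec_curv (fmetric f d) p v w =
       d ^+ 2 * (d - 1) ^+ 2 / (4 * (d - 2) ^+ 2)
       * (clebsch f p * f p / (hessdet f p) ^+ 2))
  /\
  (* intrinsic (Gauss) curvature of M, computed in any local parametrization *)
  (forall (W : set 'rV[R]_2) (phi : 'rV[R]_2 -> 'rV[R]_3) (u : 'rV[R]_2),
     open W ->
     (forall i : 'I_3, smooth_on W (fun y => phi y 0 i)) ->
     (forall y, W y -> U (phi y) /\ f (phi y) = 1) ->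
     (forall y, W y ->
        row_free (col_mx (dphi phi ord0 y) (dphi phi ord_max y))) ->
     W u ->
     sec_curv (pullback (fmetric f d) phi) u (ev ord0) (ev ord_max) =
       - (d ^+ 2 / 4)
       + d ^+ 2 * (d - 1) ^+ 2 / (4 * (d - 2) ^+ 2)
         * (clebsch f (phi u) * f (phi u) ^+ 2 / (hessdet f (phi u)) ^+ 2)).

Proof.
move=> oU sf d2 hom hne; split=> [p v w Up fp tv tw fr|W phi u oW sphi M1 imm Wu].
  exact: (ambient_sec_curv p v w oU sf d2 hom hne Up fp tv tw fr).
exact: (surface_sec_curv oU sf d2 hom hne oW sphi M1 imm u Wu).
Qed.
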